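(* Let $\mathcal M$ be the set of all subsets of $\{1,\dots,p\}$ and $\mathcal M_o=\{\{1,\dots,d\}:1\le d\le p\}\cup\{\varnothing\}$. For all $m\in\mathcal M$, let $\overline{\mathscr Q}_m=\{R_\gamma,\ \gamma\in\overline\Gamma_m\}$. Whatever the distribution of $W$, the estimator $R_{\widehat\gamma}$ given by the model selection procedure described in the context over $\{\Gamma_m,\ m\in\mathcal M\}$ with the weights $$\Delta(m)=\begin{cases}2\log(1+|m|)&\text{if }m\in\mathcal M_o,\\|m|\log\left(\frac{2ep}{|m|}\right)&\text{if }m\in\mathcal M\setminus\mathcal M_o,\end{cases}$$ satisfies $$\mathbb E\left[h^2(R_{\gamma^\star},R_{\widehat\gamma})\right]\le1.95\times10^7\,(\mathscr B_o\wedge\mathscr B_c),$$ where $$\mathscr B_o=\inf_{m\in\mathcal M_o}\left\{h^2(R_{\gamma^\star},\overline{\mathscr Q}_m)+\frac{|m|+1}n\left[1+\log_+\left(\frac n{|m|+1}\right)\right]\right\}$$ and $$\mathscr B_c=\inf_{m\in\mathcal M}\left\{h^2(R_{\gamma^\star},\overline{\mathscr Q}_m)+\frac{|m|+1}n\left[1+\log\left(\frac{(2p)\vee n}{|m|+1}\right)\right]\right\}.$$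
   Context: **Observations.** $\mathscr W\subset\mathbb R^p$, $p\ge1$. $X_i=(W_i,Y_i)$ with $W_i=(W_i^{(1)},\dots,W_i^{(p)})$, $i=1,\dots,n$, are independent, with values in $\mathscr W\times\mathscr Y$; the $W_i$ are i.i.d. with common distribution $P_W$ ($W$ denotes a variable with this law), and the conditional distribution of $Y_i$ given $W_i$ is $R_{\gamma^\star(W_i)}$ for all $i$, where $\gamma^\star$ is an unknown function on $\mathscr W$ with values in $[v_-,v_+]\subset I$ ($v_-<v_+$ known) of the form $\gamma^\star(\mathbf w)=\sum_{j=1}^p\gamma_j^\star w^{(j)}$, $\mathbf w=(w^{(1)},\dots,w^{(p)})\in\mathscr W$, $\gamma_j^\star\in\mathbb R$. **Exponential family (natural form).** $I\subset\mathbb R$ is an interval with non-empty interior, $(\mathscr Y,\mathcal Y,\mu)$ a measured space, $a\ge0$ a function on $\mathscr Y$, $\nu=a\cdot\mu$, $T$ a real-valued measurable function on $\mathscr Y$ not $\nu$-a.e. constant, $r_\gamma(y)=e^{\gamma T(y)-B(\gamma)}$ with $B(\gamma)=\log\int e^{\gamma T}d\nu$ (finite), $R_\gamma=r_\gamma\cdot\nu$, $\gamma\in I$. **Loss.** $h(P,Q)=[\frac12\int(\sqrt{p}-\sqrt{q})^2d\mu]^{1/2}$ is the Hellinger distance between probabilities with densities $p,q$ with respect to $\mu$; for measurable $\gamma,\gamma':\mathscr W\to I$, $h^2(R_\gamma,R_{\gamma'})=\int_{\mathscr W}h^2(R_{\gamma(w)},R_{\gamma'(w)})dP_W(w)$,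 and $h^2(R_{\gamma},\mathscr Q)=\inf_{R\in\mathscr Q}h^2(R_\gamma,R)$. $\log_+x=\max(0,\log x)$. **Models.** For $m\in\mathcal M$, $\overline S_m$ is the set of functions $\gamma(\mathbf w)=\sum_{j=1}^p\gamma_jw^{(j)}$ on $\mathscr W$ with $\gamma_j\in\mathbb R$ and $\gamma_j=0$ for $j\notin m$ ($\overline S_\varnothing=\{0\}$); $S_m$ is the subset with $\gamma_j\in\mathbb Q$ for all $j$. $\overline\Gamma_m=\{(\gamma\vee v_-)\wedge v_+:\gamma\in\overline S_m\}$, $\Gamma_m=\{(\gamma\vee v_-)\wedge v_+:\gamma\in S_m\}$. The VC dimension bound used for $\overline\Gamma_m$ is $V_m=|m|+1$. **Estimation procedure.** Put $\Gamma=\cup_{m\in\mathcal M}\Gamma_m$; $\psi(x)=(x-1)/(x+1)$ for $x\in[0,+\infty)$, $\psi(+\infty)=1$; $\mathbf T(\boldsymbol X,\gamma,\gamma')=\sum_{i=1}^n\psi\left(\sqrt{r_{\gamma'(W_i)}(Y_i)/r_{\gamma(W_i)}(Y_i)}\right)$ (conventions $0/0=1$, $c/0=+\infty$ for $c>0$); $D_n(m)=10^3V_m[9.11+\log_+(n/V_m)]$; $\mathrm{pen}(\gamma)=10^2\inf_{\{m:\gamma\in\Gamma_m\}}[D_n(m)+4.7\Delta(m)]$; $\upsilon(\boldsymbol X,\gamma)=\sup_{\gamma'\in\Gamma}[\mathbf T(\boldsymbol X,\gamma,\gamma')-\mathrm{pen}(\gamma')]+\mathrm{pen}(\gamma)$.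 The estimator $\widehat\gamma$ is any measurable element of $\{\gamma\in\Gamma:\upsilon(\boldsymbol X,\gamma)\le\inf_{\gamma'\in\Gamma}\upsilon(\boldsymbol X,\gamma')+1\}$. *)

(* Defs.v *)
From HB Require Import structures.
From mathcomp Require Import all_boot all_order all_algebra.
From mathcomp Require Import all_classical all_reals all_analysis.

Set Implicit Arguments.
Unset Strict Implicit.
Unset Printing Implicit Defensive.

Import Order.TTheory GRing.Theory Num.Theory.
Import numFieldNormedType.Exports.

Local Open Scope classical_set_scope.
Local Open Scope ring_scope.

(* A non-empty subset WW of R^p seen as a type, with the trace on WW of the
   Borel sigma-algebra of R^p. WW need not be Borel. Non-emptiness is what the
   library's (pointed) measurable types ask for; it is implied by the existence
   of a probability on WW. *)
Section covariate_space.
Context {R : realType} {p : nat} {WW : set (p.-tuple R)}.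

Definition covariate_space (hW : WW !=set0) : Type :=
  {w : p.-tuple R | w \in WW}.

HB.instance Definition _ (hW : WW !=set0) := Choice.on (covariate_space hW).
HB.instance Definition _ (hW : WW !=set0) :=
  isPointed.Build (covariate_space hW)
    (exist _ (projT1 (cid hW)) (mem_set (projT2 (cid hW)))).

Definition covariates (hW : WW !=set0) (w : covariate_space hW) : p.-tuple R :=
  sval w.

HB.instance Definition _ (hW : WW !=set0) :=
  Measurable.copy (covariate_space hW)
    (g_sigma_algebra_preimageType (@covariates hW)).

Definition linear_fun (hW : WW !=set0) (c : 'I_p -> R)
    (w : covariate_space hW) : R :=
  \sum_(j < p) c j * tnth (covariates w) j.

End covariate_space.

Section exponential_family.
Context {R : realType} {d : measure_display} {Y : measurableType d}.
Variables (nu : {measure set Y -> \bar R}) (T : Y -> R).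

Definition log_partition (g : R) : R :=
  ln (fine (\int[nu]_y (expR (g * T y))%:E)%E).

Definition expfam_density (g : R) (y : Y) : R :=
  expR (g * T y - log_partition g).

Definition expfam (g : R) (A : set Y) : \bar R :=
  (\int[nu]_(y in A) (expfam_density g y)%:E)%E.

End exponential_family.

Section hellinger.
Context {R : realType} {d dW : measure_display}.
Context {Y : measurableType d} {W : measurableType dW}.
Variables (mu : {measure set Y -> \bar R}) (PW : probability W R).

(* Distance between the probabilities with mu-densities f and g. *)
Definition hellinger (f g : Y -> R) : R :=
  Num.sqrt (2^-1 * (\int[mu]_y (Num.sqrt (f y) - Num.sqrt (g y)) ^+ 2)%R).

(* A conditional distribution is represented by its conditional density with
   respect to mu. *)
Definition cond_hellinger2 (q q' : W -> Y -> R) : \bar R :=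
  (\int[PW]_w ((hellinger (q w) (q' w)) ^+ 2)%:E)%E.

Definition cond_hellinger2_set (q : W -> Y -> R) (Q : set (W -> Y -> R)) :
    \bar R :=
  ereal_inf [set cond_hellinger2 q q' | q' in Q].

End hellinger.

(* The conditional distribution w |-> R_(gamma w), through its density with
   respect to mu, where nu = a . mu. *)
Definition expfam_cond {R : realType} {d : measure_display}
    {Y : measurableType d} {W : Type} (nu : {measure set Y -> \bar R})
    (a T : Y -> R) (gamma : W -> R) : W -> Y -> R :=
  fun w y => expfam_density nu T (gamma w) y * a y.

Section models.
Context {R : realType} {p : nat} {WW : set (p.-tuple R)}.
Variables (hW : WW !=set0) (vm vp : R).
Implicit Type m : {set 'I_p}.

Definition Sbar m : set (covariate_space hW -> R) :=
  [set gamma | exists c : 'I_p -> R,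
    (forall j, j \notin m -> c j = 0) /\ gamma = linear_fun c].

Definition Srat m : set (covariate_space hW -> R) :=
  [set gamma | exists c : 'I_p -> rat,
    (forall j, j \notin m -> c j = 0) /\
    gamma = linear_fun (fun j => ratr (c j))].

Definition clamp (gamma : covariate_space hW -> R) : covariate_space hW -> R :=
  fun w => Num.min (Num.max (gamma w) vm) vp.

Definition Gammabar m := [set clamp gamma | gamma in Sbar m].

Definition Gamma m := [set clamp gamma | gamma in Srat m].

Definition Gamma_union (MM : {set {set 'I_p}}) : set (covariate_space hW -> R) :=
  \bigcup_(m in [set` MM]) Gamma m.

Definition Qbar {d : measure_display} {Y : measurableType d}
    (nu : {measure set Y -> \bar R}) (a T : Y -> R) m :
    set (covariate_space hW -> Y -> R) :=
  [set expfam_cond nu a T gamma | gamma in Gammabar m].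

End models.

Arguments Gammabar {R p WW} hW vm vp m.
Arguments Gamma {R p WW} hW vm vp m.
Arguments Gamma_union {R p WW} hW vm vp MM.
Arguments Qbar {R p WW} hW vm vp {d Y} nu a T m.

Definition log_plus {R : realType} (x : R) : R := Num.max 0 (ln x).

(* psi is only meant on [0, +oo]. *)
Definition psi {R : realType} (x : \bar R) : R :=
  match x with
  | r%:E => (r - 1) / (r + 1)
  | +oo%E => 1
  | -oo%E => 0
  end.

(* The quotient x / y of non-negative reals, with 0 / 0 = 1 and c / 0 = +oo for
   c > 0. *)
Definition density_ratio {R : realType} (x y : R) : \bar R :=
  if y == 0 then (if x == 0 then 1%:E else +oo%E) else (x / y)%:E.

Definition vc_bound {p : nat} (m : {set 'I_p}) : nat := #|m|.+1.

Definition model_dim (R : realType) {p : nat} (n : nat) (m : {set 'I_p}) : R :=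
  let V : R := (vc_bound m)%:R in
  10 ^+ 3 * V * (911 / 100 + log_plus (n%:R / V)).

Section procedure.
Context {R : realType} {p n : nat} {WW : set (p.-tuple R)} {hW : WW !=set0}.
Context {d : measure_display} {Y : measurableType d}.
Variables (nu : {measure set Y -> \bar R}) (T : Y -> R) (vm vp : R).
Variables (MM : {set {set 'I_p}}) (Delta : {set 'I_p} -> R).

Local Notation W := (covariate_space hW).

Definition test_stat (x : n.-tuple (W * Y)%type) (gamma gamma' : W -> R) : R :=
  \sum_(i < n)
    psi (sqrte (density_ratio
      (expfam_density nu T (gamma' (tnth x i).1) (tnth x i).2)
      (expfam_density nu T (gamma (tnth x i).1) (tnth x i).2))).

(* The real-valued inf and sup below are taken over sets which are non-empty and
   bounded on the relevant side when gamma is in Gamma_union, vm <= vp and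
   0 <= Delta on MM, so that they are genuine infima and suprema. *)
Definition penalty (gamma : W -> R) : R :=
  10 ^+ 2 * inf [set model_dim R n m + 47 / 10 * Delta m |
                  m in [set m | m \in MM /\ Gamma hW vm vp m gamma]].

Definition upsilon (x : n.-tuple (W * Y)%type) (gamma : W -> R) : R :=
  sup [set test_stat x gamma gamma' - penalty gamma' |
        gamma' in Gamma_union hW vm vp MM] + penalty gamma.

(* Gamma_union is countable: measurability is with respect to its discrete
   sigma-algebra. *)
Definition is_estimator (ghat : n.-tuple (W * Y)%type -> W -> R) : Prop :=
  (forall gamma, Gamma_union hW vm vp MM gamma ->
    measurable [set x | ghat x = gamma]) /\
  (forall x, Gamma_union hW vm vp MM (ghat x) /\
    upsilon x (ghat x) <=
      inf [set upsilon x gamma' | gamma' in Gamma_union hW vm vp MM] + 1).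

End procedure.

Definition mutually_independent {R : realType} {d d' : measure_display}
    {Omega : measurableType d} {S : measurableType d'} {n : nat}
    (P : probability Omega R) (X : 'I_n -> Omega -> S) : Prop :=
  forall (J : {set 'I_n}) (A : 'I_n -> set S), (forall i, measurable (A i)) ->
    P (\bigcap_(i in [set` J]) (X i @^-1` A i)) =
    (\prod_(i in J) P (X i @^-1` A i))%E.

(* PW is the law of the first component of X, and the conditional distribution
   of the second one given the first one equal to w is K w. *)
Definition has_conditional_law {R : realType} {d dW dY : measure_display}
    {Omega : measurableType d} {W : measurableType dW} {Y : measurableType dY}
    (P : probability Omega R) (X : Omega -> W * Y)
    (PW : probability W R) (K : W -> set Y -> \bar R) : Prop :=
  (forall A, measurable A -> P ((fst \o X) @^-1` A) = PW A) /\
  (forall A B, measurable A -> measurable B ->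
    P (X @^-1` (A `*` B)) = (\int[PW]_(w in A) K w B)%E).

Definition all_models (p : nat) : {set {set 'I_p}} := finset.setT.

Definition initial_model {p : nat} (k : nat) : {set 'I_p} :=
  finset (fun j : 'I_p => (j < k)%N).

Definition ordered_models (p : nat) : {set {set 'I_p}} :=
  finset (fun m : {set 'I_p} =>
    (m == finset.set0) ||
    [exists k : 'I_p.+1, (1 <= k)%N && (m == initial_model k)]).

Definition weight (R : realType) {p : nat} (m : {set 'I_p}) : R :=
  if m \in ordered_models p then 2 * ln (1 + #|m|%:R)
  else #|m|%:R * ln (2 * expR 1 * p%:R / #|m|%:R).

Section bounds.
Context {R : realType} {p : nat} {WW : set (p.-tuple R)} {hW : WW !=set0}.
Context {d : measure_display} {Y : measurableType d}.
Variables (mu nu : {measure set Y -> \bar R}) (a T : Y -> R) (vm vp : R).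
Variables (PW : probability (covariate_space hW) R) (n : nat).
Variable gstar : covariate_space hW -> R.

Let bias (m : {set 'I_p}) : \bar R :=
  cond_hellinger2_set mu PW (expfam_cond nu a T gstar)
    (Qbar hW vm vp nu a T m).

Definition bound_ordered : \bar R :=
  ereal_inf [set (bias m +
      ((#|m|.+1)%:R / n%:R *
        (1 + log_plus (n%:R / (#|m|.+1)%:R)))%:E)%E
    | m in [set` ordered_models p]].

Definition bound_complete : \bar R :=
  ereal_inf [set (bias m +
      ((#|m|.+1)%:R / n%:R *
        (1 + ln ((maxn (2 * p) n)%:R / (#|m|.+1)%:R)))%:E)%E
    | m in [set` all_models p]].

End bounds.

(* Main.v *)
Require Import Defs.
From HB Require Import structures.
From mathcomp Require Import all_boot all_order all_algebra.
From mathcomp Require Import all_classical all_reals all_analysis.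
From mathcomp Require Import measurable_realfun.
From mathcomp Require Import zify ring lra.

Set Implicit Arguments.
Unset Strict Implicit.
Unset Printing Implicit Defensive.

Import Order.TTheory GRing.Theory Num.Theory.
Import numFieldNormedType.Exports.

Local Open Scope classical_set_scope.
Local Open Scope ring_scope.

(* Fix an oracle element g0 of a model m0. Since the statistic is antisymmetric,
   everything reduces to upper deviations, uniform over the countable family of
   candidates g, of sum_i f_g (X_i) with f_g = psi (sqrt (r_g / r_g0)). With
   respect to the true law, the mean of f_g is at most
   7/2 h^2(g*, g0) - 3/8 h^2(g*, g), and that of f_g^2 at most
   4 (h^2(g*, g0) + h^2(g*, g)); so it suffices to bound
     E sup_g (sum_i (f_g (X_i) - E f_g) - n E f_g^2 / 25 - pen g)^+
   by a constant. A ghost sample X' is used to symmetrize this quantity after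
   writing f = u - f^2/50 with u = f + f^2/50: the negative quadratic terms are
   kept on both samples and compensate the exponential moment of the Rademacher
   sums of u (X_i) - u (X'_i), so that no concentration inequality is needed.
   Conditionally on both samples each model is replaced by a finite net: up to
   2/L the vector of the f_g at the 2n points only depends on which of a family
   of upper sets of R contain the values of g at these points (the superlevel
   sets of t |-> r_t(y) are intervals), and such traces of a linear family of
   dimension |m| have VC dimension at most |m|. With L of order n/(|m| + 1) the
   net is far smaller than exp (pen / 256), and the weights sum up over the
   models. When n <= |m| + 1 the penalty already exceeds the statistic. *)

(** * Shattering and linear families *)

(** The comparison element must itself be a competitor of the procedure, hence have rational
    coefficients; real ones are reached at the very end by dominated convergence, at the price of
    [1 / n] in the bias. The enumeration of candidates runs over pairs (model, coefficients), each
    penalised at its own model, and the penalty of a function is realised by one of its pairs.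
    Clipping is built into the densities, so that candidates are indexed by unclipped predictors and
    the linear structure stays visible to shattering. The rate 1/25 of the quadratic offset is a
    compromise: 4/25 is small enough against 3/8 to leave 43/200 of the Hellinger loss, and 1/25 is
    large enough to absorb the second-order term of an exponential moment at scale 1/256.
    Measurability shapes the rest: suprema run over the natural numbers, and non-measurable
    integrands are handled by monotonicity alone. *)

Section shattering.
Variable T : finType.
Implicit Types (F : {set {set T}}) (A B D K : {set T}).

Definition shatters F K :=
  [forall B : {set T}, (B \subset K) ==> [exists A in F, A :&: K == B]].

Lemma shattersP F K :
  reflect (forall B, B \subset K -> exists2 A, A \in F & A :&: K = B)
          (shatters F K).
Proof.
apply: (iffP forallP) => [h B BK|h B].
  by have /implyP/(_ BK)/exists_inP[A AF /eqP] := h B; exists A.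
by apply/implyP => /h[A AF AB]; apply/exists_inP; exists A => //; apply/eqP.
Qed.

(* Pajor's form of the Sauer-Shelah lemma. *)
Lemma card_le_shattered F : (#|F| <= #|finset (shatters F)|)%N.
Proof.
have [D] : exists D, forall A, A \in F -> A \subset D.
  by exists finset.setT => A _; exact: finset.subsetT.
have [n] := ubnP #|D|; elim: n D F => // n IHn D F; rewrite ltnS => Dn FD.
have [->|[A0 A0F]] := set_0Vmem F; first by rewrite cards0.
have [D0|[x xD]] := set_0Vmem D.
  have F1 : F \subset [set finset.set0]%SET.
    by apply/fintype.subsetP => A /FD; rewrite D0 finset.subset0 inE.
  apply: (leq_trans (subset_leq_card F1)); rewrite cards1 card_gt0.
  apply/set0Pn; exists finset.set0; rewrite inE; apply/shattersP => B.
  by rewrite finset.subset0 => /eqP ->; exists A0 => //; rewrite finset.setI0.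
(* Split [F] at [x]: the sets avoiding [x], and the sets containing [x] with [x] removed. Both
   families live on [D :\ x], where induction applies. *)
pose F0 := [set A in F | x \notin A]%SET.
pose Fx := [set A in F | x \in A]%SET.
pose F1 := [set A :\ x | A in Fx]%SET.
have subD A : A \subset D -> x \notin A -> A \subset D :\ x.
  by move=> AD xA; rewrite subsetD1 AD.
have cD : (#|D :\ x| < n)%N.
  by rewrite (cardsD1 x) xD in Dn.
have F0D A : A \in F0 -> A \subset D :\ x.
  by rewrite inE => /andP[/FD AD xA]; exact: subD.
have F1D A : A \in F1 -> A \subset D :\ x.
  case/imsetP => B; rewrite inE => /andP[/FD BD xB] ->.
  by apply: finset.setSD.
have cF : #|F| = (#|F0| + #|F1|)%N.
  rewrite card_in_imset; last first.
    move=> A B; rewrite !inE => /andP[_ xA] /andP[_ xB] AB.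
    by rewrite -(finset.setD1K xA) -(finset.setD1K xB) AB.
  rewrite -(cardsID [set A : {set T} | x \in A]%SET F) addnC.
  by congr (_ + _)%N; apply: eq_card => A; rewrite !inE// andbC.
have shD F' K : (forall A, A \in F' -> A \subset D :\ x) -> shatters F' K ->
    x \notin K.
  move=> F'D /shattersP/(_ K (subxx _))[A /F'D AD AK].
  have /fintype.subsetP KA : K \subset A by rewrite -AK finset.subsetIl.
  by apply/negP => /KA/(fintype.subsetP AD); rewrite !inE eqxx.
set S0 := finset (shatters F0); set S1 := finset (shatters F1).
rewrite cF; apply: (@leq_trans (#|S0| + #|S1|)).
  by apply: leq_add; apply: (IHn (D :\ x)).
(* A set [K] shattered by both halves is counted twice, but then [F] shatters [x |: K] besides [K];
   adding [x] to the members of the intersection gives sets outside the union. *)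
rewrite -cardsUI -(@card_in_imset _ _ (fun K => x |: K) (mem (S0 :&: S1))); last first.
  move=> K K'; rewrite !inE => /andP[/shD-/(_ F0D) xK _] /andP[/shD-/(_ F0D) xK' _] KK'.
  by rewrite -(finset.setU1K xK) -(finset.setU1K xK') KK'.
rewrite -cardsUI [X in (_ + X)%N](_ : _ = 0)%N ?addn0; last first.
  apply/eqP; rewrite cards_eq0 -finset.subset0; apply/fintype.subsetP => K.
  rewrite !inE => /andP[+ /imsetP[K' _ KE]].
  have xK : x \in K by rewrite KE !inE eqxx.
  by case/orP => /shD; [move/(_ F0D)|move/(_ F1D)]; rewrite xK.
apply: subset_leq_card; apply/fintype.subsetP => K; rewrite !inE.
case/orP => [/orP[]|] sh.
- apply/shattersP => B BK; have [A] := elimT (shattersP _ _) sh B BK.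
  rewrite inE => /andP[AF _] <-.
  by exists A.
- have xK := shD _ _ F1D sh.
  apply/shattersP => B BK; have [C /imsetP[A]] := elimT (shattersP _ _) sh B BK.
  rewrite inE => /andP[AF _] -> <-.
  exists A => //; apply/finset.setP => y; rewrite !inE; case: eqVneq => //= ->.
  by rewrite (negbTE xK) andbF.
- case/imsetP: sh => K'; rewrite inE => /andP[]; rewrite !inE => sh0 sh1 ->.
  have xK := shD _ _ F0D sh0.
  move: sh0 sh1 => /shattersP sh0 /shattersP sh1.
  apply/shattersP => B BK.
  have BK' : B :\ x \subset K'.
    apply/fintype.subsetP => y; rewrite !inE => /andP[yx /(fintype.subsetP BK)].
    by rewrite !inE (negbTE yx).
  have [xB|xB] := boolP (x \in B).
    have [C /imsetP[A]] := sh1 _ BK'; rewrite inE => /andP[AF xA] -> AB.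
    exists A => //; apply/finset.setP => y; move/finset.setP/(_ y) : AB; rewrite !inE.
    by case: eqVneq => [->|_] //=; rewrite xA xB.
  have [A] := sh0 _ BK'; rewrite inE => /andP[AF xA] AB.
  exists A => //; apply/finset.setP => y; move/finset.setP/(_ y) : AB; rewrite !inE.
  by case: eqVneq => [->|_] //=; rewrite (negbTE xA) (negbTE xB).
Qed.

(** Weigh a set [K] by [x ^+ #|K|]: shattered sets weigh at least [x ^+ d] since [x <= 1], and all
    subsets together weigh [(1 + x) ^+ #|T|]. The free [x] replaces the binomial sum of the
    Sauer-Shelah bound and is tuned to the sample size later. *)
Lemma card_le_vc (R : numFieldType) F (d : nat) (x : R) : 0 < x -> x <= 1 ->
  (forall K, shatters F K -> (#|K| <= d)%N) ->
  #|F|%:R <= x ^- d * (1 + x) ^+ #|T|.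
Proof.
move=> x0 x1 dimF.
rewrite mulrC ler_pdivlMr ?exprn_gt0//.
apply: (@le_trans _ _ (#|finset (shatters F)|%:R * x ^+ d)).
  apply: ler_wpM2r; first by rewrite exprn_ge0// ltW.
  by rewrite ler_nat card_le_shattered.
rewrite -sum1_card natr_sum mulr_suml.
have -> : (1 + x) ^+ #|T| = \sum_(K : {set T}) x ^+ #|K|.
  rewrite -prodr_const addrC bigA_distr/=; apply: eq_bigr => K _.
  rewrite (bigID (mem K))/= [X in _ * X]big1 ?mulr1; last first.
    by move=> i /negbTE ->.
  by rewrite -prodr_const; apply: eq_bigr => i ->.
rewrite [leRHS](bigID (mem (finset (shatters F))))/=.
rewrite -[leLHS]addr0; apply: lerD; last first.
  by apply: sumr_ge0 => K _; rewrite exprn_ge0// ltW.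
apply: ler_sum => K; rewrite inE mul1r => /dimF Kd.
by apply: ler_wiXn2l => //; exact: ltW.
Qed.

End shattering.

(* Upper level sets of the coordinates of a linear family: if [K] were
   shattered and larger than the dimension, a linear relation [lam] between the
   points of [K] would separate the points with [lam > 0] from those with
   [lam < 0] in two opposite ways. *)
Lemma linear_vc_dim (R : realFieldType) (p : nat) (T : finType)
    (v : T -> 'I_p -> R) (U : T -> pred R) (m : {set 'I_p})
    (F : {set {set T}}) :
  (forall k s t, s <= t -> U k s -> U k t) ->
  (forall A, A \in F -> exists2 c : 'I_p -> R,
     forall j, j \notin m -> c j = 0 &
     A = finset (fun k => U k (\sum_j c j * v k j))) ->
  forall K, shatters F K -> (#|K| <= #|m|)%N.
Proof.
move=> upU FP K /shattersP sh; rewrite leqNgt; apply/negP => mK.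
pose A : 'M[R]_(#|K|, #|m|) := \matrix_(i, j) v (enum_val i) (enum_val j).
have : kermx A != 0.
  rewrite -mxrank_eq0 mxrank_ker subn_eq0 -ltnNge.
  exact: leq_ltn_trans (rank_leq_col A) mK.
case/rowV0Pn => lam /sub_kermxP lamA lam0.
pose Bp := [set k | [exists i : 'I_#|K|, (k == enum_val i) && (0 < lam 0 i)]]%SET.
pose Bn := [set k | [exists i : 'I_#|K|, (k == enum_val i) && (lam 0 i < 0)]]%SET.
have inBp i : (enum_val i \in Bp) = (0 < lam 0 i).
  rewrite inE; apply/existsP/idP => [[j /andP[/eqP/enum_val_inj <-]]//|l0].
  by exists i; rewrite eqxx.
have inBn i : (enum_val i \in Bn) = (lam 0 i < 0).
  rewrite inE; apply/existsP/idP => [[j /andP[/eqP/enum_val_inj <-]]//|l0].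
  by exists i; rewrite eqxx.
have BpK : Bp \subset K.
  by apply/fintype.subsetP => k; rewrite inE => /existsP[i /andP[/eqP -> _]]; exact: enum_valP.
have BnK : Bn \subset K.
  by apply/fintype.subsetP => k; rewrite inE => /existsP[i /andP[/eqP -> _]]; exact: enum_valP.
have [A1 /FP[c1 c1m ->] /finset.setP e1] := sh _ BpK.
have [A2 /FP[c2 c2m ->] /finset.setP e2] := sh _ BnK.
pose L c k := \sum_j c j * v k j.
have LmE (c : 'I_p -> R) : (forall j, j \notin m -> c j = 0) ->
    \sum_i lam 0 i * L c (enum_val i) = 0.
  move=> cm.
  under eq_bigr do rewrite mulr_sumr.
  rewrite exchange_big/= big1// => j _.
  have [jm|/cm ->] := boolP (j \in m); last by rewrite big1// => i _; rewrite mul0r mulr0.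
  have := congr1 (fun B : 'rV_ _ => B 0 (enum_rank_in jm j)) lamA.
  rewrite !mxE => e; transitivity (c j * 0); last exact: mulr0.
  rewrite -[in RHS]e mulr_sumr.
  by apply: eq_bigr => i _; rewrite mxE enum_rankK_in// mulrCA.
(* Where [lam > 0] the point lies in the first trace and not in the second, conversely where
   [lam < 0]; upper sets turn this into a strict comparison of the two predictors. The terms of a
   vanishing sum are thus non-negative, with equality only at [lam = 0]. *)
have cmp i : 0 <= lam 0 i * (L c1 (enum_val i) - L c2 (enum_val i)) /\
    (lam 0 i * (L c1 (enum_val i) - L c2 (enum_val i)) = 0 -> lam 0 i = 0).
  have := e1 (enum_val i); have := e2 (enum_val i).
  rewrite !finset.in_setI inBp inBn enum_valP !andbT !finset.in_set -/(L _ _).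
  have lt s t : U (enum_val i) t = true -> U (enum_val i) s = false -> s < t.
    move=> Ut Us; rewrite ltNge; apply/negP => ts.
    by rewrite (upU _ _ _ ts) in Us.
  case: ltgtP => [l0|l0|l0] h2 h1.
  - have l12 := lt _ _ h2 h1; split; first by rewrite mulr_le0 ?ltW// subr_lt0.
    by move/eqP; rewrite mulf_eq0 (lt_eqF l0) subr_eq0 (lt_eqF l12).
  - have l12 := lt _ _ h1 h2; split; first by rewrite mulr_ge0 ?ltW// subr_gt0.
    by move/eqP; rewrite mulf_eq0 (gt_eqF l0) subr_eq0 (gt_eqF l12).
  - by have -> : lam 0 i = 0 by []; rewrite mul0r.
have : \sum_i lam 0 i * (L c1 (enum_val i) - L c2 (enum_val i)) == 0.
  under eq_bigr do rewrite mulrBr.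
  by rewrite sumrB !LmE ?subrr.
rewrite psumr_eq0 => [/allP h|i _]; last by case: (cmp i).
case/eqP: lam0; apply/rowP => i; rewrite mxE.
have [_] := cmp i; apply; apply/eqP.
exact: h i (mem_index_enum _).
Qed.

(** * Sign averages and finite nets *)

Lemma expR_le_quadratic (R : realType) (x : R) : `|x| <= 1 / 2 ->
  expR x <= 1 + x + 2 * x ^+ 2.
Proof.
rewrite ler_norml => /andP[x1 x2].
have h : 1 - x <= expR (- x) by have := expR_ge1Dx (- x).
have x10 : 0 < 1 - x by lra.
have -> : expR x = (expR (- x))^-1 by rewrite expRN invrK.
apply: (@le_trans _ _ (1 - x)^-1).
  by rewrite lef_pV2// posrE ?expR_gt0.
(* Amounts to [0 <= x ^+ 2 * (1 - 2 * x)]. *)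
rewrite -[leLHS]mul1r ler_pdivrMr//; nra.
Qed.

(** The sum over sign patterns factors into a product over [i], where the linear terms of the two
    exponentials cancel. The second hypothesis lets [b] absorb the remaining quadratic terms, so
    that the bound does not depend on [s]. *)
Lemma sum_signs_expR_le (R : realType) (n : nat) (lam b : R) (s : 'I_n -> R) :
  (forall i, `|lam * s i| <= 1 / 2) ->
  2 * lam ^+ 2 * (\sum_i s i ^+ 2) <= lam * b ->
  \sum_(e : {set 'I_n})
    expR (lam * (\sum_i (if i \in e then - s i else s i) - b)) <= 2 ^+ n.
Proof.
move=> sle sb.
under eq_bigr => e _.
  rewrite mulrBr mulr_sumr expRD expR_sum.
  under eq_bigr => i _ do rewrite (fun_if (fun t => expR (lam * t))).
  over.
rewrite -mulr_suml -bigA_distr expRN ler_pdivrMr ?expR_gt0//.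
apply: (@le_trans _ _ (\prod_(i < n) (2 * expR (2 * lam ^+ 2 * s i ^+ 2)))).
  apply: ler_prod => i _; rewrite addr_ge0 ?expR_ge0//=.
  have h1 := expR_le_quadratic (sle i).
  have h2 : expR (lam * - s i) <= 1 - lam * s i + 2 * (lam * s i) ^+ 2.
    by rewrite mulrN -[X in 2 * X]sqrrN expR_le_quadratic// normrN.
  have := expR_ge1Dx (2 * lam ^+ 2 * s i ^+ 2).
  rewrite !exprMn in h1 h2 *; lra.
rewrite big_split/= prodr_const card_ord ler_wpM2l ?exprn_ge0//.
by rewrite -expR_sum ler_expR -mulr_sumr.
Qed.

Section net.
Context {R : realType} {p : nat} {N : finType} {J : Type}.
Variables (v : N -> 'I_p -> R) (phi : N -> R -> R) (L : nat).
Variables (m : {set 'I_p}) (co : J -> 'I_p -> R) (D : set J).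
Hypothesis L0 : (0 < L)%N.
Hypothesis phi1 : forall k t, `|phi k t| <= 1.
Hypothesis phiq : forall k r s t, r <= s -> s <= t ->
  Num.min (phi k r) (phi k t) <= phi k s.
Hypothesis Dm : forall j, D j -> forall i, i \notin m -> co j i = 0.

Let lin j k := \sum_i co j i * v k i.
Let level (l : 'I_L.+1) : R := - 1 + 2 * l%:R / L%:R.
Let T : finType := (N * 'I_L.+1 * bool)%type.

(* A superlevel set of [phi k] is an interval: it is the upper set generated by
   it ([b = true]) minus the points lying strictly above it ([b = false]). *)
Let up (k : T) : pred R := fun t =>
  let: (i, l, b) := k in
  `[< exists2 s, s <= t & level l <= phi i s >] && (b || (phi i t < level l)).

Let up_up k s t : s <= t -> up k s -> up k t.
Proof.
case: k => [[i l] b] st /= /andP[/asboolP[r rs lr] h].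
apply/andP; split; first by apply/asboolP; exists r => //; exact: le_trans st.
case: b h => //= h; rewrite ltNge; apply/negP => lt.
have := phiq i rs st; rewrite ge_min => /orP[] h'.
  by move: (le_lt_trans h' h); rewrite ltNge lr.
by move: (le_lt_trans h' h); rewrite ltNge lt.
Qed.

Let pat j : {set T} := finset (fun k => up k (lin j k.1.1)).

Let pat_close j j' : pat j = pat j' ->
  forall k, `|phi k (lin j k) - phi k (lin j' k)| <= 2 / L%:R.
Proof.
move=> jj' k.
have upE l t : (level l <= phi k t) = up (k, l, true) t && ~~ up (k, l, false) t.
  rewrite /= andbT; case: asboolP => /= h; last first.
    by apply: contra_notF h => h; exists t.
  by rewrite -leNgt.
have E l : (level l <= phi k (lin j k)) = (level l <= phi k (lin j' k)).
  rewrite !upE; have /setP e := jj'.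
  by have := e (k, l, true); have := e (k, l, false); rewrite !finset.in_set => -> ->.
have L0' : 0 < L%:R :> R by rewrite ltr0n.
have aux (s t : R) : `|s| <= 1 -> `|t| <= 1 ->
    (forall l, (level l <= s) = (level l <= t)) -> s - t <= 2 / L%:R.
  rewrite !ler_norml => /andP[s1 s2] /andP[t1 t2] st.
  (* [level l] is the highest level not exceeding [s]; it does not exceed [t] either, so [s - t] is
     less than one step. The case [s = 1] gives [l = L], hence the [L + 1] levels. *)
  pose l := Num.truncn ((s + 1) / 2 * L%:R).
  have s0 : 0 <= (s + 1) / 2 * L%:R by rewrite mulr_ge0// divr_ge0//; lra.
  have /andP[l1 l2] := truncn_itv s0.
  have lL : (l < L.+1)%N.
    rewrite ltnS -(ler_nat R); apply: (le_trans l1).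
    by rewrite ler_piMl//; lra.
  have := st (Ordinal lL); rewrite /level/= -/l => e.
  have : - 1 + 2 * l%:R / L%:R <= s.
    have : l%:R / L%:R <= (s + 1) / 2 by rewrite ler_pdivrMr.
    lra.
  rewrite e => lt.
  have : (s + 1) / 2 < l.+1%:R / L%:R by rewrite ltr_pdivlMr.
  rewrite -(natr1 l) (mulrDl l%:R); lra.
rewrite ler_norml lerNl opprB; apply/andP; split; apply: aux => // l.
Qed.

(** Points, levels and both kinds of upper sets are gathered into one ground set [T], so that a
    candidate is recorded by a single subset of it. The shattering dimension is still at most
    [#|m|]: [L] only enters through the size of the ground set. *)
Lemma finite_net (j0 : J) (x : R) : D j0 -> 0 < x -> x <= 1 ->
  exists F : {set {set T}}, exists rep : {set T} -> J,
  [/\ #|F|%:R <= x ^- #|m| * (1 + x) ^+ (4 * #|N| * L.+1),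
      forall A, A \in F -> D (rep A) &
      forall j, D j -> exists2 A, A \in F &
        forall k, `|phi k (lin j k) - phi k (lin (rep A) k)| <= 2 / L%:R].
Proof.
move=> Dj0 x0 x1.
pose F : {set {set T}} := finset (fun A => `[< exists2 j, D j & pat j = A >]).
have FP A : A \in F -> exists2 j, D j & pat j = A by rewrite inE => /asboolP.
have [rep repP] : {rep : {set T} -> J &
    forall A, A \in F -> D (rep A) /\ pat (rep A) = A}.
  apply: (@boolp.choice _ _ (fun A j => A \in F -> D j /\ pat j = A)) => A.
  have [/FP[j Dj <-]|] := boolP (A \in F).
    by exists j.
  by move=> _; exists j0.
exists F, rep; split.
- apply: (@le_trans _ _ (x ^- #|m| * (1 + x) ^+ #|T|)).
    apply: card_le_vc => //; apply: (@linear_vc_dim R p T (fun k => v k.1.1) up).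
      by move=> k s t; exact: up_up.
    move=> A /FP[j Dj <-]; exists (co j); first exact: Dm.
    by [].
  apply: ler_wpM2l; first by rewrite invr_ge0 exprn_ge0 ?ltW.
  apply: ler_weXn2l; first by rewrite lerDl ltW.
  by rewrite !card_prod card_ord card_bool; lia.
- by move=> A /repP[].
- move=> j Dj; exists (pat j).
    by rewrite inE; apply/asboolP; exists j.
  move=> k; apply: pat_close.
  have /repP[_ ->]// : pat j \in F by rewrite inE; apply/asboolP; exists j.
Qed.
End net.

(** * Symmetrized process with a quadratic offset *)

Section offset_process.
Context {R : realType} {n : nat}.
Implicit Types (f g : 'I_n * bool -> R) (e : {set 'I_n}).

(** Without swaps, [tilt f - tilt f' - (f ^+ 2 + f' ^+ 2) / 50] equals [f - f' - f' ^+ 2 / 25]: the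
    quadratic term falls on the ghost copy [f'] alone, and integrating that copy out leaves only its
    moments. *)
Definition tilt (t : R) : R := t + t ^+ 2 / 50.

Definition tilt_diff f i : R := tilt (f (i, false)) - tilt (f (i, true)).

Definition offset f : R :=
  (\sum_i (f (i, false) ^+ 2 + f (i, true) ^+ 2)) / 50.

Definition offset_process f e : R :=
  \sum_i (if i \in e then - tilt_diff f i else tilt_diff f i) - offset f.

Lemma offset_ge0 f : 0 <= offset f.
Proof.
by apply: divr_ge0 => //; apply: sumr_ge0 => i _; rewrite addr_ge0 ?sqr_ge0.
Qed.

Lemma tilt_diff_le f i : (forall k, `|f k| <= 1) -> `|tilt_diff f i| <= 51 / 25.
Proof.
move=> f1; have := f1 (i, false); have := f1 (i, true).
rewrite /tilt_diff /tilt !ler_norml => /andP[? ?] /andP[? ?].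
by apply/andP; split; nra.
Qed.

Lemma offset_process_le f e : (forall k, `|f k| <= 1) ->
  offset_process f e <= 51 / 25 * n%:R.
Proof.
move=> f1; rewrite /offset_process; have off0 := offset_ge0 f.
apply: (@le_trans _ _ (\sum_(i < n) (51 / 25))); last first.
  by rewrite sumr_const card_ord mulr_natr.
rewrite -[leRHS]subr0; apply: lerB => //.
apply: ler_sum => i _; have := tilt_diff_le i f1; rewrite ler_norml.
by case: ifP => _ /andP[? ?]; lra.
Qed.

(** On [[-1, 1]] the square is 2-Lipschitz: per index, two values of [tilt] cost [2 * (1 + 2 / 50)]
    and the offset [4 / 50], which makes [54 / 25]. *)
Lemma offset_process_close f g e (d : R) :
  (forall k, `|f k| <= 1) -> (forall k, `|g k| <= 1) ->
  (forall k, `|f k - g k| <= d) ->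
  offset_process f e <= offset_process g e + 54 / 25 * d * n%:R.
Proof.
move=> f1 g1 fg.
have d0 (i : 'I_n) : 0 <= d by exact: le_trans (fg (i, true)).
suff : offset_process f e - offset_process g e <= \sum_(i < n) (54 / 25 * d).
  by rewrite sumr_const card_ord -[_ *+ n]mulr_natr lerBlDl.
rewrite /offset_process /offset !mulr_suml -!sumrB; apply: ler_sum => i _.
have := f1 (i, false); have := f1 (i, true).
have := g1 (i, false); have := g1 (i, true).
have := fg (i, false); have := fg (i, true).
have := d0 i.
rewrite /tilt_diff /tilt !ler_norml.
move: (f _) (f _) (g _) (g _) => a a' b b' {}d0.
move=> /andP[u1 u2] /andP[w1 w2] /andP[? ?] /andP[? ?] /andP[? ?] /andP[? ?].
have sq (s t : R) : -1 <= s -> s <= 1 -> -1 <= t -> t <= 1 -> - d <= s - t ->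
    s - t <= d -> - (2 * d) <= s ^+ 2 - t ^+ 2 /\ s ^+ 2 - t ^+ 2 <= 2 * d.
  by move=> *; rewrite subr_sqr; split; nra.
have [] : - (2 * d) <= a ^+ 2 - b ^+ 2 /\ a ^+ 2 - b ^+ 2 <= 2 * d by apply: sq.
have [] : - (2 * d) <= a' ^+ 2 - b' ^+ 2 /\ a' ^+ 2 - b' ^+ 2 <= 2 * d by apply: sq.
by case: ifP => _; lra.
Qed.

(* The offset [(f^2 + f'^2) / 50] absorbs the quadratic term
   [2 (u - u')^2 / 256] of the exponential moment since [|u| <= 51/50 |f|]. *)
Lemma sum_expR_offset_process_le f : (forall k, `|f k| <= 1) ->
  \sum_e expR (256^-1 * offset_process f e) <= 2 ^+ n.
Proof.
move=> f1; apply: (@sum_signs_expR_le _ _ 256^-1 (offset f) (tilt_diff f)).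
  move=> i; have := tilt_diff_le i f1; rewrite !ler_norml => /andP[? ?].
  by apply/andP; split; lra.
rewrite /offset mulr_suml !mulr_sumr; apply: ler_sum => i _.
have := f1 (i, false); have := f1 (i, true); rewrite /tilt_diff /tilt.
move: (f _) (f _) => a b; rewrite !ler_norml => /andP[? ?] /andP[? ?].
have sq (s : R) : -1 <= s -> s <= 1 ->
    (s + s ^+ 2 / 50) ^+ 2 <= (51 / 50) ^+ 2 * s ^+ 2.
  move=> *; rewrite [X in X ^+ 2](_ : _ = s * (1 + s / 50)); last by field.
  rewrite exprMn mulrC ler_wpM2r ?sqr_ge0//.
  by rewrite ler_sqr ?nnegrE; lra.
have h1 : (a + a ^+ 2 / 50) ^+ 2 <= (51 / 50) ^+ 2 * a ^+ 2 by apply: sq.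
have h2 : (b + b ^+ 2 / 50) ^+ 2 <= (51 / 50) ^+ 2 * b ^+ 2 by apply: sq.
move: h1 h2; move: (a + _) (b + _) => s t h1 h2.
have h3 : (s - t) ^+ 2 <= 2 * (s ^+ 2 + t ^+ 2) by have := sqr_ge0 (s + t); nra.
have h4 : (t - s) ^+ 2 <= 2 * (s ^+ 2 + t ^+ 2) by have := sqr_ge0 (s + t); nra.
by have := sqr_ge0 a; have := sqr_ge0 b; lra.
Qed.

End offset_process.

Lemma log_plus_ge0 (R : realType) (x : R) : 0 <= log_plus x.
Proof. by rewrite /log_plus le_max lexx. Qed.

Lemma log_plus_ge1 (R : realType) (x : R) : 1 <= x -> log_plus x = ln x.
Proof. by move=> x1; rewrite /log_plus max_r// ln_ge0. Qed.

(** The net costs [V * (2 * l + 24)] and its error [5 * V / 256]. Since [10 ^+ 4 / 256 > 39] and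
    [400 / 256 > 1], the rescaled penalty [q / 256] pays for both and still leaves [V + D]. *)
Lemma exponent_le (R : realFieldType) (V l t D q : R) :
  0 <= V -> 0 <= V * l -> 0 <= D -> t <= 5 * V ->
  10 ^+ 4 * (V * (1 + l)) + 10 ^+ 2 * 4 * D <= q ->
  V * (2 * l + 24) + 256^-1 * (t - q) <= - (V + D).
Proof. lra. Qed.

Lemma small_sample_le (R : realFieldType) (V l t D q N : R) :
  0 <= V -> 0 <= V * l -> 0 <= D -> t <= 51 / 25 * N -> N <= V ->
  10 ^+ 4 * (V * (1 + l)) + 10 ^+ 2 * 4 * D <= q -> t - q <= 0.
Proof. lra. Qed.

(** * Supremum of the symmetrized process over one model *)

Section model.
Context {R : realType} {n p : nat} {J : Type}.
Variables (v : 'I_n * bool -> 'I_p -> R) (phi : 'I_n * bool -> R -> R).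
Variables (m : {set 'I_p}) (co : J -> 'I_p -> R) (D : set J) (j0 : J).
Variables (V Delta q : R).
Hypothesis VE : V = (vc_bound m)%:R.
Hypothesis Delta0 : 0 <= Delta.
Hypothesis qE :
  10 ^+ 4 * (V * (1 + log_plus (n%:R / V))) + 10 ^+ 2 * 4 * Delta <= q.
Hypothesis phi1 : forall k t, `|phi k t| <= 1.
Hypothesis phiq : forall k r s t, r <= s -> s <= t ->
  Num.min (phi k r) (phi k t) <= phi k s.
Hypothesis Dm : forall j, D j -> forall i, i \notin m -> co j i = 0.
Hypothesis Dj0 : D j0.

Let lin j k := \sum_i co j i * v k i.
Let f j k := phi k (lin j k).

(** Each value is dominated through [t <= 256 * expR (t / 256)], and the maximum over the net by a
    sum, which is averaged over the sign patterns term by term. *)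
Lemma model_sup_bound : exists G : {set 'I_n} -> R,
  [/\ forall e, 0 <= G e,
      forall e j, D j -> offset_process (f j) e - q <= G e &
      \sum_e G e <= 2 ^+ n * (256 * expR (- (V + Delta)))].
Proof.
have V1 : 1 <= V by rewrite VE ler1n.
have f1 j k : `|f j k| <= 1 by exact: phi1.
have lp0 := log_plus_ge0 (n%:R / V).
(* With at most [V] observations the trivial bound [51 / 25 * n] is below the penalty. *)
have [nV|Vn] := leP (n%:R : R) V.
  exists (fun=> 0); split; first by move=> e; exact: lexx.
  - move=> e j Dj; have := offset_process_le e (f1 j).
    move=> h; apply: small_sample_le h nV qE => //; first by rewrite (le_trans _ V1).
    by rewrite mulr_ge0// (le_trans _ V1).
  - rewrite big1 => [|//].
    by apply: mulr_ge0; [exact: exprn_ge0|apply: mulr_ge0 => //; exact: expR_ge0].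
have V0 : 0 < V by lra.
have n0 : (0 : R) < n%:R by exact: lt_trans Vn.
have nV1 : 1 <= n%:R / V by rewrite ler_pdivlMr// mul1r ltW.
move: qE; rewrite log_plus_ge1// in lp0 * => qE'.
(* The resolution [2 / L], with [L] just above [n / V], gives an error of order [V], while [n > V]
   keeps [L + 1] below [3 * n / V]. *)
pose L := (n %/ vc_bound m).+1.
have LV1 : n%:R / V <= L%:R.
  rewrite VE ler_pdivrMr ?ltr0n// -natrM ler_nat mulSn; have := leq_trunc_div n (vc_bound m).
  have := divn_eq n (vc_bound m); have := ltn_pmod n (ltn0Sn #|m|).
  rewrite -/(vc_bound m); lia.
have LV2 : L.+1%:R <= 3 * (n%:R / V).
  have : (n %/ vc_bound m)%:R <= n%:R / V.
    by rewrite VE ler_pdivlMr ?ltr0n// -natrM ler_nat leq_trunc_div.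
  by rewrite /L -[X in X.+1.+1%:R]addn0 -addnS -addnS natrD => h; lra.
have L0 : 0 < L%:R :> R by rewrite ltr0n.
(* This [x] makes the two factors of the net bound [expR (2 * #|m| * l)] and at most
   [expR (24 * V)], as [4 * (2 * n) * (3 * n / V) * x = 24 * V]. *)
pose x := (V / n%:R) ^+ 2.
have Vn1 : V / n%:R <= 1 by rewrite ler_pdivrMr// mul1r ltW.
have Vn0 : 0 < V / n%:R by rewrite divr_gt0.
have x0 : 0 < x by rewrite exprn_gt0.
have x1 : x <= 1 by rewrite expr_le1// ltW.
have [F [rep [cF FD Frep]]] :=
  @finite_net R p ('I_n * bool)%type J v phi L m co D (ltn0Sn _) phi1 phiq Dm j0 x Dj0 x0 x1.
set l := ln (n%:R / V) in lp0 qE' *.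
have cF' : #|F|%:R <= expR (V * (2 * l + 24)).
  apply: (le_trans cF); rewrite mulrDr expRD; apply: ler_pM => //.
  - by rewrite invr_ge0 exprn_ge0// ltW.
  - by rewrite exprn_ge0// addr_ge0// ltW.
  - have -> : x ^- #|m| = expR ((2 * #|m|)%:R * l).
      rewrite expRM_natl lnK ?posrE ?divr_gt0// /x -exprM -exprVn.
      by congr (_ ^+ _); rewrite invf_div.
    rewrite ler_expR natrM (mulrC 2) -mulrA.
    apply: ler_wpM2r; first by rewrite mulr_ge0.
    by rewrite VE ler_nat /vc_bound leqnSn.
  - apply: (@le_trans _ _ (expR x ^+ (4 * #|{: 'I_n * bool}| * L.+1))).
      by apply: lerXn2r; rewrite ?nnegrE ?expR_ge0 ?expR_ge1Dx// addr_ge0// ltW.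
    rewrite -expRM_natl ler_expR card_prod card_bool card_ord !natrM.
    apply: (@le_trans _ _ (4 * (n%:R * 2) * (3 * (n%:R / V)) * x)).
      apply: ler_wpM2r; first exact: ltW.
      by apply: ler_wpM2l => //; rewrite !mulr_ge0// ltW.
    rewrite /x le_eqVlt; apply/orP; left; apply/eqP; field.
    by rewrite !gt_eqF.
pose err := 54 / 25 * (2 / L%:R) * n%:R : R.
have errV : err <= 5 * V.
  have : n%:R / L%:R <= V by rewrite ler_pdivrMr// mulrC -ler_pdivrMr.
  by rewrite /err; lra.
pose G e := \sum_(A in F) 256 * expR (256^-1 *
  (offset_process (f (rep A)) e + err - q)).
exists G; split.
- by move=> e; apply: sumr_ge0 => A _; rewrite mulr_ge0 ?expR_ge0.
- move=> e j Dj; have [A AF Aj] := Frep j Dj.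
  rewrite /G (bigD1 A)//=.
  rewrite -[leLHS]addr0; apply: lerD; last first.
    by apply: sumr_ge0 => B _; rewrite mulr_ge0 ?expR_ge0.
  have := offset_process_close e (f1 j) (f1 (rep A)) Aj; rewrite -/err.
  set a := offset_process _ _; set b := offset_process _ _.
  move=> ab; have := expR_ge1Dx (256^-1 * (b + err - q)); lra.
- rewrite /G exchange_big/=.
  apply: (@le_trans _ _ (\sum_(A in F) 256 * expR (256^-1 * (err - q)) * 2 ^+ n)).
    apply: ler_sum => A AF.
    under eq_bigr do rewrite -addrA mulrDr expRD mulrCA.
    rewrite -mulr_suml mulrC ler_wpM2l ?mulr_ge0 ?expR_ge0//.
    exact: sum_expR_offset_process_le.
  set E := expR (_ * _).
  have -> : \sum_(A in F) 256 * E * 2 ^+ n = 2 ^+ n * (256 * (#|F|%:R * E)).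
    by rewrite sumr_const -[_ *+ #|F|]mulr_natl; ring.
  rewrite ler_wpM2l ?exprn_ge0// ler_wpM2l//.
  apply: (le_trans (ler_wpM2r (expR_ge0 _) cF')).
  rewrite /E -expRD ler_expR.
  apply: exponent_le qE' => //; first exact: ltW.
  by rewrite mulr_ge0// ltW.
Qed.
End model.

(** * Penalties and weights *)

Definition model_pen (R : realType) {p : nat} (n : nat)
    (Delta : {set 'I_p} -> R) (m : {set 'I_p}) : R :=
  10 ^+ 2 * (model_dim R n m + 47 / 10 * Delta m).

Section weights.
Context {R : realType} {p : nat}.
Implicit Type m : {set 'I_p}.

Lemma card_model_le m : (#|m| <= p)%N.
Proof. by rewrite -[leqRHS]card_ord max_card. Qed.

Lemma ordered_model_unique m m' : m \in ordered_models p ->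
  m' \in ordered_models p -> #|m| = #|m'| -> m = m'.
Proof.
have E m1 : m1 \in ordered_models p -> m1 = initial_model #|m1|.
  rewrite inE => /orP[/eqP ->|/existsP[k /andP[_ /eqP ->]]].
    by rewrite cards0; apply/setP => j; rewrite !inE.
  have -> // : #|@initial_model p k| = k.
  have kp : (k <= p)%N by rewrite -ltnS.
  rewrite (_ : initial_model k = [set widen_ord kp i | i in 'I_k]%SET).
    by rewrite card_imset ?card_ord// => i j /(congr1 val)/= /val_inj.
  apply/setP => j; rewrite inE; apply/idP/imsetP => [jk|[i _ ->]] //=.
  by exists (Ordinal jk) => //; apply: val_inj.
by move=> /E + /E + mm' => -> ->; rewrite mm'.
Qed.

Lemma weight_unorderedE m : m \notin ordered_models p ->
  [/\ (0 < #|m|)%N, weight R m = #|m|%:R * ln (2 * expR 1 * p%:R / #|m|%:R) &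
      weight R m = #|m|%:R * (1 + ln ((2 * p)%:R / #|m|%:R))].
Proof.
move=> mo; rewrite /weight (negbTE mo).
have m0 : (0 < #|m|)%N.
  rewrite lt0n cards_eq0; apply: contra mo => /eqP ->.
  by rewrite inE eqxx.
have p0 : (0 < p)%N := leq_trans m0 (card_model_le m).
split => //; congr (_ * _).
have -> : 2 * expR 1 * p%:R / #|m|%:R = expR 1 * ((2 * p)%:R / #|m|%:R) :> R.
  by rewrite natrM; ring.
by rewrite lnM ?posrE ?expR_gt0 ?expRK// divr_gt0// ltr0n// muln_gt0.
Qed.

Lemma weight_ge0 m : 0 <= weight R m.
Proof.
have [mo|/weight_unorderedE[m0 _ ->]] := boolP (m \in ordered_models p).
  by rewrite /weight mo mulr_ge0// ln_ge0// lerDl.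
rewrite mulr_ge0// addr_ge0// ln_ge0//.
rewrite ler_pdivlMr ?ltr0n// mul1r ler_nat.
by rewrite (leq_trans (card_model_le m))// leq_pmull.
Qed.

(* ['C(p, d) <= p^d / d!] and [d^d <= d! e^d]. *)
Lemma card_models_weight_le (d : nat) : (0 < d <= p)%N ->
  'C(p, d)%:R * expR (- (d%:R * ln (2 * expR 1 * p%:R / d%:R))) <= 1 :> R.
Proof.
move=> /andP[d0 dp].
have p0 : (0 < p)%N := leq_trans d0 dp.
have d0' : 0 < d%:R :> R by rewrite ltr0n.
have p0' : 0 < p%:R :> R by rewrite ltr0n.
have q0 : 0 < 2 * expR 1 * p%:R / d%:R :> R by rewrite divr_gt0 ?mulr_gt0 ?expR_gt0.
rewrite expRN expRM_natl lnK ?posrE//.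
rewrite ler_pdivrMr ?exprn_gt0// mul1r.
have h1 : 'C(p, d)%:R * d`!%:R <= p%:R ^+ d :> R.
  rewrite -natrM -natrX ler_nat bin_ffact ffact_prod.
  rewrite -[in leqRHS](card_ord d) -prod_nat_const.
  by apply: leq_prod => i _; exact: leq_subr.
have h2 : d%:R ^+ d <= d`!%:R * expR 1 ^+ d :> R.
  rewrite -expRM_natl mulr1 mulrC -ler_pdivrMr ?ltr0n ?fact_gt0//.
  case: d d0 {dp d0' q0 h1} => // d _.
  by have := @expR_ge1Dxn R d.+1%:R d (ler0n _ _); lra.
have f0 : 0 < d`!%:R :> R by rewrite ltr0n fact_gt0.
rewrite -(ler_pM2r f0) (le_trans h1)//.
have [hd he] : 0 < d%:R ^+ d :> R /\ 1 <= 2 ^+ d :> R.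
  by rewrite exprn_gt0// exprn_ege1// ler1n.
rewrite expr_div_n !exprMn.
rewrite [leRHS](_ : _ = p%:R ^+ d * (2 ^+ d * (d`!%:R * expR 1 ^+ d)) / d%:R ^+ d); last by ring.
rewrite ler_pdivlMr//.
rewrite ler_wpM2l ?exprn_ge0// (le_trans h2)// ler_peMl//.
Qed.

(** Each size [d] has at most one ordered model, and the unordered ones of that size have total
    weight at most one; with the factor [expR (- (d + 1))] the sizes contribute at most twice a
    series dominated by a geometric one of ratio 1/2. *)
Lemma sum_weights_le :
  \sum_(m : {set 'I_p}) expR (- ((vc_bound m)%:R + weight R m)) <= 2.
Proof.
pose w (d : nat) : R := expR (- (d.+1%:R)).
have w0 d : 0 <= w d by exact: expR_ge0.
have wsum q : \sum_(d < q) w d <= 1.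
  suff : \sum_(d < q) w d <= 1 - 2 ^- q.
    by move=> h; apply: (le_trans h); rewrite gerBl invr_ge0 exprn_ge0.
  elim: q => [|q IH]; first by rewrite big_ord0 expr0 invr1 subrr.
  rewrite big_ord_recr/=.
  suff : w q <= 2 ^- q.+1.
    by rewrite exprS invfM => h; lra.
  rewrite /w expRN lef_pV2 ?posrE ?expR_gt0 ?exprn_gt0//.
  rewrite -[X in expR X]mulr1 expRM_natl lerXn2r ?nnegrE ?expR_ge0//.
  by have := expR_ge1Dx (1 : R); lra.
rewrite (partition_big (fun m => inord #|m| : 'I_p.+1) predT)//=.
apply: (@le_trans _ _ (\sum_(d < p.+1) 2 * w d)); last first.
  by rewrite -mulr_sumr -[leRHS]mulr1 ler_wpM2l.
apply: ler_sum => d _.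
have dE m : (inord #|m| == d) = (#|m| == d :> nat).
  by rewrite -val_eqE/= inordK// ltnS card_model_le.
under eq_bigl do rewrite dE.
rewrite (bigID (fun m => m \in ordered_models p))/= mulr2n mulrDl !mul1r.
apply: lerD.
  have [[m0 /andP[m0d m0o]]|no] := pselect (exists m, (#|m| == d) && (m \in ordered_models p)).
    rewrite (bigD1 m0) ?m0d//= big1 ?addr0.
      by rewrite /w -(eqP m0d) ler_expR lerN2 lerDl weight_ge0.
    move=> m /andP[/andP[md mo]] /eqP; case.
    by apply: ordered_model_unique => //; rewrite (eqP md) (eqP m0d).
  rewrite big1// => m mm; exfalso; apply: no; by exists m.
have [->|d0] := posnP d.
  rewrite big1// => m /andP[]; rewrite cards_eq0 => /eqP ->.
  by rewrite inE eqxx.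
apply: (@le_trans _ _ (\sum_(m : {set 'I_p} | #|m| == d)
    w d * expR (- (d%:R * ln (2 * expR 1 * p%:R / d%:R))))).
  rewrite [leRHS](bigID (fun m => m \in ordered_models p))/=.
  rewrite -[leLHS]add0r; apply: lerD.
    by apply: sumr_ge0 => m _; rewrite mulr_ge0 ?expR_ge0.
  apply: ler_sum => m /andP[/eqP md /weight_unorderedE[_ -> _]].
  by rewrite /w -expRD ler_expR opprD /vc_bound md.
rewrite sumr_const -[_ *+ #|_|]mulr_natl mulrCA.
have -> : #|[pred m : {set 'I_p} | #|m| == d]| = 'C(p, d).
  transitivity #|[set A : {set 'I_p} | #|A| == d]%SET|.
    by apply: eq_card => m; rewrite !inE.
  by rewrite card_draws card_ord.
rewrite -[leRHS]mulr1 ler_wpM2l//.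
by apply: card_models_weight_le; rewrite d0 -ltnS ltn_ord.
Qed.

Lemma ln_le_subr1 (x : R) : 0 < x -> ln x <= x - 1.
Proof.
move=> x0; have := expR_ge1Dx (ln x); rewrite lnK ?posrE//; lra.
Qed.

(** The constant 9.11 yields [911000 * V], and the weight at most [940 * (V - 1)] by
    [ln V <= V - 1]; [10 ^+ 6] covers both. *)
Lemma model_pen_ordered_le n m : m \in ordered_models p ->
  model_pen n (weight R) m <=
  10 ^+ 6 * ((vc_bound m)%:R * (1 + log_plus (n%:R / (vc_bound m)%:R))).
Proof.
move=> mo; rewrite /model_pen /model_dim /weight mo.
have -> : 1 + #|m|%:R = (vc_bound m)%:R :> R by rewrite /vc_bound -natr1 addrC.
set V : R := (vc_bound m)%:R.
have V1 : 1 <= V by rewrite ler1n.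
have V0 : 0 < V by exact: lt_le_trans V1.
have := ln_le_subr1 V0.
have : 0 <= V * log_plus (n%:R / V) by rewrite mulr_ge0 ?log_plus_ge0// ltW.
lra.
Qed.

Lemma model_pen_le n m : (0 < p)%N ->
  model_pen n (weight R) m <=
  10 ^+ 6 * ((vc_bound m)%:R * (1 + ln ((maxn (2 * p) n)%:R / (vc_bound m)%:R))).
Proof.
move=> p0; set V : R := (vc_bound m)%:R.
have V1 : 1 <= V by rewrite ler1n.
have V0 : 0 < V by exact: lt_le_trans V1.
have Vp : V <= (2 * p)%:R.
  by rewrite ler_nat /vc_bound mul2n -addnn -addn1 leq_add// card_model_le.
have Vmax : V <= (maxn (2 * p) n)%:R.
  by apply: (le_trans Vp); rewrite ler_nat leq_maxl.
have Vp1 : 1 <= (2 * p)%:R / V by rewrite ler_pdivlMr// mul1r.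
have Vmax1 : 1 <= (maxn (2 * p) n)%:R / V by rewrite ler_pdivlMr// mul1r.
have lp : log_plus (n%:R / V) <= ln ((maxn (2 * p) n)%:R / V).
  rewrite /log_plus ge_max ln_ge0//=.
  have [->|n0] := posnP n; first by rewrite mul0r ln0 ?ln_ge0// le_max.
  rewrite ler_ln ?posrE ?divr_gt0 ?ltr0n//; last by rewrite leq_max n0 orbT.
  by apply: ler_wpM2r; [rewrite invr_ge0 ltW|rewrite ler_nat]; rewrite ?leq_maxr.
have lp2 : ln ((2 * p)%:R / V) <= ln ((maxn (2 * p) n)%:R / V).
  rewrite ler_ln ?posrE; [|exact: lt_le_trans Vp1|exact: lt_le_trans Vmax1].
  by apply: ler_wpM2r; [rewrite invr_ge0 ltW|rewrite ler_nat]; rewrite ?leq_maxl.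
have [mo|mo] := boolP (m \in ordered_models p).
  apply: (le_trans (model_pen_ordered_le n mo)); rewrite -/V.
  apply: ler_wpM2l; first exact: exprn_ge0.
  by apply: ler_wpM2l; [exact: ltW|rewrite lerD2l].
have [m0 _ wE] := weight_unorderedE mo.
(* Replacing [d = #|m|] by [V = d + 1] inside the logarithm costs at most 1, as
   [ln (1 + 1 / d) <= 1 / d]; this is paid by [V - d = 1]. *)
have wle : weight R m <= V * (1 + ln ((2 * p)%:R / V)).
  rewrite wE; set d : R := #|m|%:R.
  have d0 : 0 < d by rewrite ltr0n.
  have VE : V = d + 1 by rewrite /V /vc_bound -natr1.
  have P0 : 0 < (2 * p)%:R :> R by rewrite ltr0n muln_gt0.
  have l1 : 0 <= ln ((2 * p)%:R / V) by rewrite ln_ge0.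
  have l2 : ln V - ln d <= d^-1.
    rewrite -ln_div ?posrE//.
    apply: (le_trans (ln_le_subr1 _)); first by rewrite divr_gt0.
    by rewrite VE mulrDl mulfV ?gt_eqF// div1r addrAC subrr add0r.
  have l3 : d * (ln V - ln d) <= 1.
    by rewrite -[leRHS](mulfV (lt0r_neq0 d0)) ler_wpM2l// ltW.
  rewrite !ln_div ?posrE// in l1 *; rewrite VE in l1 *; rewrite VE in l3.
  nra.
rewrite /model_pen /model_dim -/V.
have : V * log_plus (n%:R / V) <= V * ln ((maxn (2 * p) n)%:R / V).
  by rewrite ler_wpM2l// ltW.
have : V * ln ((2 * p)%:R / V) <= V * ln ((maxn (2 * p) n)%:R / V).
  by rewrite ler_wpM2l// ltW.
have : 0 <= V * ln ((maxn (2 * p) n)%:R / V) by rewrite mulr_ge0 ?ln_ge0// ltW.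
lra.
Qed.

End weights.

(** * Symmetrization *)

(** A non-negative integral is a supremum over the simple functions below the integrand, hence
    monotone without measurability. This allows the risk, as a function of the outcome, to be
    compared with a measurable bound. *)
Lemma ge0_le_integral_nonmeas (R : realType) (d : measure_display)
    (T : measurableType d) (mu : {measure set T -> \bar R}) (f g : T -> \bar R) :
  (forall x, 0 <= f x)%E -> (forall x, f x <= g x)%E ->
  (\int[mu]_x f x <= \int[mu]_x g x)%E.
Proof.
move=> f0 fg; have g0 x : (0 <= g x)%E by exact: le_trans (fg x).
rewrite !ge0_integralTE//; apply: le_ereal_sup => _ [h hf <-].
by exists h => // x; exact: le_trans (hf x) (fg x).
Qed.

Section ghost_sample.
Context {R : realType} {d dS : measure_display} {Omega : measurableType d}.
Context {S : measurableType dS} {n : nat}.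
Variables (P : probability Omega R) (X : 'I_n -> {mfun Omega >-> S}).
Hypothesis indepX : mutually_independent P (fun i => X i : Omega -> S).

Let SS : measurableType _ := (S * S)%type.
Let ZZ : measurableType _ := n.-tuple SS.

Definition paired_sample (e : {set 'I_n}) (w : Omega * Omega) :
    ZZ :=
  [tuple if i \in e then (X i w.2, X i w.1) else (X i w.1, X i w.2) | i < n].

Lemma measurable_paired_sample e : measurable_fun setT (paired_sample e).
Proof.
apply/measurable_fun_tnthP => i; rewrite (_ : _ \o _ = fun w : Omega * Omega =>
  if i \in e then (X i w.2, X i w.1) else (X i w.1, X i w.2)); last first.
  by apply/funext => w /=; rewrite tnth_mktuple.
have mX1 : measurable_fun setT (fun w : Omega * Omega => X i w.1).
  exact: measurableT_comp.
have mX2 : measurable_fun setT (fun w : Omega * Omega => X i w.2).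
  exact: measurableT_comp.
by case: (i \in e); exact: measurable_fun_pair.
Qed.

Let box (A B : 'I_n -> set S) : set ZZ :=
  [set z | forall i, A i (tnth z i).1 /\ B i (tnth z i).2].

Let paired_sample_box e A B :
  (forall i, measurable (A i)) -> (forall i, measurable (B i)) ->
  (P \x P)%E (paired_sample e @^-1` box A B) =
  (\prod_i (P (X i @^-1` A i) * P (X i @^-1` B i)))%E.
Proof.
move=> mA mB.
pose A' i := if i \in e then B i else A i.
pose B' i := if i \in e then A i else B i.
have mA' i : measurable (A' i) by rewrite /A'; case: ifP.
have mB' i : measurable (B' i) by rewrite /B'; case: ifP.
have -> : paired_sample e @^-1` box A B =
    (\bigcap_(i in [set` (finset.setT : {set 'I_n})]) (X i @^-1` A' i)) `*`
    (\bigcap_(i in [set` (finset.setT : {set 'I_n})]) (X i @^-1` B' i)).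
  apply/seteqP; split => [w h|w [/= h1 h2] i].
    by split => i _ /=; have := h i; rewrite tnth_mktuple /A' /B';
      case: (i \in e) => -[].
  have := h1 i (finset.in_setT _); have := h2 i (finset.in_setT _).
  by rewrite tnth_mktuple /A' /B' /=; case: (i \in e).
have mcap C : (forall i, measurable (C i)) ->
    measurable (\bigcap_(i in [set` (finset.setT : {set 'I_n})]) (X i @^-1` C i)).
  move=> mC; apply: fin_bigcap_measurable => // i _.
  by rewrite -[X in measurable X]setTI; exact: measurable_funP.
rewrite product_measure1E//; [|exact: mcap|exact: mcap].
transitivity ((\prod_(i in finset.setT) P (X i @^-1` A' i)) *
  (\prod_(i in finset.setT) P (X i @^-1` B' i)))%E.
  by congr (_ * _)%E; exact: indepX.
rewrite -big_split/=.
apply: eq_big => [i|i _]; first by rewrite finset.in_setT.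
by rewrite /A' /B'; case: ifP => // _; rewrite muleC.
Qed.

(** On a box, both laws give the product over [i] of the probabilities that [X i] falls in [A i] and
    in [B i], which does not see the swap; boxes are stable under intersection and generate. Each
    [X i] is only exchanged with its own copy. *)
Lemma paired_sample_law e (G : ZZ -> \bar R) :
  measurable_fun setT G -> (forall z, 0 <= G z)%E ->
  (\int[P \x P]_w G (paired_sample e w) =
   \int[P \x P]_w G (paired_sample finset.set0 w))%E.
Proof.
move=> mG G0.
have mps e' := measurable_paired_sample e'.
rewrite -[LHS](@ge0_integral_pushforward _ _ _ _ _ _ (mps e) (P \x P)%E setT G)//; last first.
rewrite -[RHS](@ge0_integral_pushforward _ _ _ _ _ _ (mps finset.set0) (P \x P)%E setT G)//.
pose BB : set (set ZZ) :=
  [set C | exists A B, [/\ forall i, measurable (A i),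
                         forall i, measurable (B i) & C = box A B]].
apply: eq_measure_integral => C mC _.
have mtup : measurable = <<s BB >>.
  apply/seteqP; split; last first.
    apply: smallest_sub; first exact: sigma_algebra_measurable.
    move=> _ [A [B [mA mB ->]]].
    have -> : box A B = \bigcap_(i in [set` (finset.setT : {set 'I_n})])
        (((fun z => (tnth z i).1) @^-1` A i) `&` ((fun z => (tnth z i).2) @^-1` B i)).
      apply/seteqP; split => [z h i _|z h i]; first exact: h.
      by apply: h; rewrite /= finset.in_setT.
    apply: fin_bigcap_measurable => // i _; apply: measurableI.
      rewrite -[X in measurable X]setTI; apply: (measurableT_comp measurable_fst) => //.
      exact: measurable_tnth.
    rewrite -[X in measurable X]setTI; apply: (measurableT_comp measurable_snd) => //.
    exact: measurable_tnth.
  suff mid : measurable_fun setT (id : g_sigma_algebraType BB -> ZZ).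
    by move=> A mA; have := mid measurableT A mA; rewrite setTI.
  apply/measurable_fun_tnthP => i; apply/measurable_fun_pairP; split.
    move=> _ A mA; rewrite setTI; apply: sub_sigma_algebra.
    exists (fun j => if j == i then A else setT), (fun=> setT); split => //.
      by move=> j; case: ifP.
    apply/seteqP; split => [z /= h j|z h].
      by split => //; case: eqP => // ->.
    by have [] := h i; rewrite eqxx.
  move=> _ A mA; rewrite setTI; apply: sub_sigma_algebra.
  exists (fun=> setT), (fun j => if j == i then A else setT); split => //.
    by move=> j; case: ifP.
  apply/seteqP; split => [z /= h j|z h].
    by split => //; case: eqP => // ->.
  by have [] := h i; rewrite eqxx.
apply: (measure_unique BB (fun=> setT)) => //.
- move=> _ _ [A [B [mA mB ->]]] [A' [B' [mA' mB' ->]]].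
  exists (fun i => A i `&` A' i), (fun i => B i `&` B' i); split.
  + by move=> i; exact: measurableI.
  + by move=> i; exact: measurableI.
  + apply/seteqP; split => [z [h h'] i|z h].
      by have [? ?] := h i; have [? ?] := h' i.
    by split => i; have [[? ?] [? ?]] := h i.
- move=> _; exists (fun=> setT), (fun=> setT); split => //.
  by apply/seteqP; split.
- by rewrite bigcup_const//; exists 0%N.
- by move=> _ [A [B [mA mB ->]]]; rewrite /= /pushforward !paired_sample_box.
- by move=> _; rewrite /= /pushforward preimage_setT probability_setT ltry.
Qed.

End ghost_sample.

Lemma le_bounded_integrable (R : realType) (d : measure_display)
    (T : measurableType d) (P : probability T R) (f : T -> R) (C : R) :
  measurable_fun setT f -> (forall x, `|f x| <= C) ->
  P.-integrable setT (EFin \o f).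
Proof.
move=> mf fC; apply: measurable_bounded_integrable => //.
  exact: le_lt_trans (probability_le1 P measurableT) (ltry _).
exists C; split; first by rewrite num_real.
by move=> x Cx y _ /=; exact: le_trans (fC y) (ltW Cx).
Qed.

Section symmetrization.
Context {R : realType} {d dS : measure_display} {Omega : measurableType d}.
Context {S : measurableType dS} {n : nat}.
Variables (P : probability Omega R) (X : 'I_n -> {mfun Omega >-> S}).
Hypothesis indepX : mutually_independent P (fun i => X i : Omega -> S).
Variables (f : nat -> S -> R) (a b pen : nat -> R) (B : R).
Hypothesis mf : forall k, measurable_fun setT (f k).
Hypothesis f1 : forall k x, `|f k x| <= 1.
Hypothesis fa : forall k i, (\int[P]_w (f k (X i w))%:E = (a k)%:E)%E.
Hypothesis fb : forall k i, (\int[P]_w (f k (X i w) ^+ 2)%:E = (b k)%:E)%E.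
Hypothesis sup_bound : forall z : 'I_n * bool -> S,
  exists G : {set 'I_n} -> R,
  [/\ forall e, 0 <= G e,
      forall e k, offset_process (f k \o z) e - pen k <= G e &
      \sum_e G e <= 2 ^+ n * B].

Let SS : measurableType _ := (S * S)%type.
Let ZZ : measurableType _ := n.-tuple SS.

Let points (z : ZZ) (ib : 'I_n * bool) : S :=
  if ib.2 then (tnth z ib.1).2 else (tnth z ib.1).1.

Let gap k (z : ZZ) : R := offset_process (f k \o points z) finset.set0 - pen k.

Let gap_sup (z : ZZ) : \bar R := esups (fun k => (Num.max 0 (gap k z))%:E) 0%N.

Definition deviation k w : R :=
  \sum_i f k (X i w) - n%:R * a k - n%:R * b k / 25 - pen k.

Lemma measurable_fun_points ib : measurable_fun setT (points ^~ ib).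
Proof.
case: ib => i [].
  by apply: (measurableT_comp measurable_snd); exact: measurable_tnth.
by apply: (measurableT_comp measurable_fst); exact: measurable_tnth.
Qed.

Let measurable_gap k : measurable_fun setT (gap k).
Proof.
have mp ib : measurable_fun setT (fun z => f k (points z ib)).
  by apply: measurableT_comp => //; exact: measurable_fun_points.
have mt i : measurable_fun setT (fun z => tilt_diff (f k \o points z) i).
  have mt ib : measurable_fun setT (fun z => tilt (f k (points z ib))).
    apply: measurable_funD; first exact: mp.
    by apply: measurable_funM => //; apply: measurable_funX; exact: mp.
  by apply: measurable_funB; exact: mt.
apply: measurable_funB => //; apply: measurable_funB.
  apply: measurable_sum => i; case: (i \in finset.set0) => //.
  exact: measurableT_comp.
apply: measurable_funM => //; apply: measurable_sum => i.
by apply: measurable_funD; apply: measurable_funX; exact: mp.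
Qed.

Let measurable_gap_sup : measurable_fun setT gap_sup.
Proof.
apply: measurable_fun_esups => k; apply/measurable_EFinP.
by apply: measurable_maxr => //; exact: measurable_cst.
Qed.

Let gap_sup_ub k z : ((Num.max 0 (gap k z))%:E <= gap_sup z)%E.
Proof. by apply: ereal_sup_ubound; exists k. Qed.

Let gap_sup_ge0 z : (0 <= gap_sup z)%E.
Proof. by apply: le_trans (gap_sup_ub 0 z); rewrite lee_fin le_max lexx. Qed.

(** Exchanging the pair at [i] flips the sign of [tilt_diff] there and leaves the offset, symmetric
    in the two copies, unchanged. *)
Let gap_swap k e w : gap k (paired_sample X e w) =
  offset_process (f k \o points (paired_sample X finset.set0 w)) e - pen k.
Proof.
rewrite /gap /offset_process; congr (_ - _ - _).
  apply: eq_bigr => i _.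
  rewrite finset.in_set0 /tilt_diff /points/= !tnth_mktuple finset.in_set0.
  by case: (i \in e) => //=; rewrite opprB.
congr (_ / _); apply: eq_bigr => i _.
rewrite /points/= !tnth_mktuple finset.in_set0.
by case: (i \in e) => //=; rewrite addrC.
Qed.

Let integral_gap_sup_le :
  (\int[P \x P]_w gap_sup (paired_sample X finset.set0 w) <= B%:E)%E.
Proof.
set J := (\int[P \x P]_w _)%E.
have n0 : 0 < (2 ^+ n : R) by rewrite exprn_gt0.
have mps e := measurable_paired_sample X e.
(* All [2 ^+ n] exchanges give the same integral [J], so [2 ^+ n * J] is the integral of a sum over
   sign patterns, to which the pointwise hypothesis applies. *)
have JE : ((2 ^+ n)%:E * J = \sum_(e : {set 'I_n})
    \int[P \x P]_w gap_sup (paired_sample X e w))%E.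
  rewrite (eq_bigr (fun=> J)); last first.
    by move=> e _; apply: paired_sample_law.
  rewrite (eq_bigr (fun=> 1%:E * J)%E); last by move=> e _; rewrite mul1e.
  rewrite -ge0_sume_distrl// sumEFin sumr_const; congr (_%:E * _)%E.
  rewrite -natrX; congr _%:R; rewrite -[in LHS](card_ord n) -cardsT -card_powerset.
  by apply: eq_card => e; rewrite !inE finset.subsetT.
suff : ((2 ^+ n)%:E * J <= (2 ^+ n)%:E * B%:E)%E by rewrite lee_pmul2l// lte_fin.
rewrite JE -ge0_integral_sum//; last by move=> e; exact: measurableT_comp.
apply: (@le_trans _ _ (\int[P \x P]_w (2 ^+ n * B)%:E)%E).
  apply: ge0_le_integral_nonmeas => [w|w]; first exact: sume_ge0.
  have [G [G0 Gub GB]] := sup_bound (points (paired_sample X finset.set0 w)).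
  apply: (@le_trans _ _ (\sum_e (G e)%:E)%E); last by rewrite sumEFin lee_fin.
  apply: lee_sum => e _; apply: ub_ereal_sup => _ [k _ <-].
  by rewrite lee_fin ge_max G0 gap_swap Gub.
by rewrite integral_cst// [X in (_ * X)%E]probability_setT mule1 EFinM.
Qed.

(** Integrating out the ghost copy [w'] turns [gap] into [deviation] exactly, and the mean of [gap]
    is at most the mean of its supremum. *)
Let deviation_le k w :
  ((deviation k w)%:E <= \int[P]_w' gap_sup (paired_sample X finset.set0 (w, w')))%E.
Proof.
pose h i w' := f k (X i w') + f k (X i w') ^+ 2 / 25.
have mfX i : measurable_fun setT (fun w' => f k (X i w')) by exact: measurableT_comp.
have fXi i : P.-integrable setT (EFin \o (fun w' => f k (X i w'))).
  by apply: (@le_bounded_integrable _ _ _ _ _ 1).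
have fX2i i : P.-integrable setT (EFin \o (fun w' => f k (X i w') ^+ 2)).
  apply: (@le_bounded_integrable _ _ _ _ _ 1); first exact: measurable_funX.
  by move=> w'; rewrite normrX expr_le1.
have gapE w' : gap k (paired_sample X finset.set0 (w, w')) =
    (\sum_i f k (X i w) - pen k) - \sum_i h i w'.
  rewrite /gap /offset_process /offset mulr_suml -sumrB addrAC -sumrB.
  congr (_ - _); apply: eq_bigr => i _.
  rewrite finset.in_set0 /tilt_diff /points/= !tnth_mktuple finset.in_set0/=.
  by rewrite /tilt /h; lra.
have hi i : P.-integrable setT (EFin \o h i).
  have -> : EFin \o h i = (EFin \o (fun w' => f k (X i w'))) \+
    (fun w' => 25^-1%:E * (EFin \o (fun w' => (f k (X i w') ^+ 2)%R)) w')%E.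
    by apply/funext => w' /=; rewrite -EFinM -EFinD mulrC.
  by apply: integrableD => //; exact: integrableZl.
have hE i : (\int[P]_w' (h i w')%:E = (a k + b k / 25)%:E)%E.
  rewrite (_ : (fun w' => _) = (EFin \o (fun w' => f k (X i w'))) \+
    (fun w' => 25^-1%:E * (EFin \o (fun w' => (f k (X i w') ^+ 2)%R)) w')%E); last first.
    by apply/funext => w' /=; rewrite -EFinM -EFinD mulrC.
  rewrite integralD//; last exact: integrableZl.
  by rewrite integralZl//= fa fb -EFinM -EFinD mulrC.
have shi : P.-integrable setT (EFin \o (fun w' => \sum_i h i w')).
  have -> : EFin \o (fun w' => \sum_i h i w') =
      (fun w' => \sum_i (EFin \o h i) w')%E.
    by apply/funext => w' /=; rewrite sumEFin.
  exact: integrable_sum.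
have cst_i : P.-integrable setT (EFin \o cst (\sum_i f k (X i w) - pen k)).
  exact: finite_measure_integrable_cst.
have devE : ((deviation k w)%:E =
    \int[P]_w' (gap k (paired_sample X finset.set0 (w, w')))%:E)%E.
  under eq_integral do rewrite gapE EFinB.
  rewrite integralB_EFin// integral_cst// [X in (_ * X)%E]probability_setT mule1.
  have -> : (\int[P]_w' (\sum_i h i w')%:E = \sum_(i < n) (a k + b k / 25)%:E)%E.
    under eq_integral do rewrite -sumEFin.
    by rewrite integral_sum//; apply: eq_bigr => i _; exact: hE.
  rewrite sumEFin sumr_const card_ord -EFinB /deviation; congr (_%:E).
  by rewrite -[_ *+ n]mulr_natl; lra.
rewrite devE.
apply: (@le_trans _ _ (\int[P]_w'
    (Num.max 0 (gap k (paired_sample X finset.set0 (w, w'))))%:E)%E).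
  rewrite integralE; apply: (@le_trans _ _ (\int[P]_w'
    (fun w' => (gap k (paired_sample X finset.set0 (w, w')))%:E)^\+ w')%E).
    by apply: geeDl; rewrite oppe_le0 integral_ge0.
  apply: ge0_le_integral_nonmeas => w'; first by rewrite funepos_ge0.
  by rewrite funeposE -EFin_max maxC.
apply: ge0_le_integral_nonmeas => w' //.
by rewrite lee_fin le_max lexx.
Qed.

Lemma symmetrization :
  (\int[P]_w ereal_sup [set (Num.max 0 (deviation k w))%:E | k in setT]
   <= B%:E)%E.
Proof.
apply: le_trans integral_gap_sup_le.
rewrite fubini_tonelli1//; last first.
  exact: measurableT_comp (measurable_paired_sample X finset.set0).
apply: ge0_le_integral_nonmeas => w.
  apply: le_trans (ereal_sup_ubound _); last by exists 0%N.
  by rewrite lee_fin le_max lexx.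
apply: ub_ereal_sup => _ [k _ <-]; rewrite EFin_max ge_max.
by rewrite integral_ge0//= deviation_le.
Qed.
End symmetrization.

(** * Densities and Hellinger distance *)

Section density_measure.
Context {R : realType} {d : measure_display} {T : measurableType d}.
Variables (mu : {measure set T -> \bar R}) (k : T -> R).
Hypotheses (k0 : forall x, 0 <= k x) (mk : measurable_fun setT k).

Definition density_measure (A : set T) : \bar R := (\int[mu]_(x in A) (k x)%:E)%E.

Let density_measure0 : density_measure set0 = 0%E.
Proof. exact: integral_set0. Qed.

Let density_measure_ge0 A : (0 <= density_measure A)%E.
Proof. by apply: integral_ge0 => x _; rewrite lee_fin. Qed.

Let density_measure_sigma_additive : semi_sigma_additive density_measure.
Proof.
move=> F mF tF mUF; rewrite /density_measure ge0_integral_bigcup//.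
- by apply: is_cvg_ereal_nneg_natsum_cond => n _ _; exact: density_measure_ge0.
- exact/measurable_EFinP/(measurable_funS measurableT).
- by move=> x _; rewrite lee_fin.
Qed.

HB.instance Definition _ := isMeasure.Build _ _ _ density_measure
  density_measure0 density_measure_ge0 density_measure_sigma_additive.

Definition density_measure_measure : {measure set T -> \bar R} := density_measure.

End density_measure.

Section integral_density.
Local Open Scope ereal_scope.
Context {R : realType} {d : measure_display} {T : measurableType d}.
Variables (mu nu : {measure set T -> \bar R}) (k : T -> R).
Hypotheses (k0 : forall x, (0 <= k x)%R) (mk : measurable_fun setT k).
Hypothesis nuE : forall A, measurable A -> nu A = \int[mu]_(x in A) (k x)%:E.

Import HBNNSimple.

(** [mu] is an arbitrary measure, possibly not sigma-finite, so the formula is obtained directly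
    from simple functions and monotone convergence. *)
Lemma ge0_integral_density (f : T -> \bar R) :
  measurable_fun setT f -> (forall x, 0 <= f x) ->
  \int[nu]_x f x = \int[mu]_x (f x * (k x)%:E).
Proof.
move=> mf f0.
pose f_ := nnsfun_approx measurableT mf.
have mkE : measurable_fun setT (fun x => (k x)%:E) by exact/measurable_EFinP.
have fE x : f x = limn (fun n => (f_ n x)%:E).
  by apply/esym/cvg_lim => //; exact: cvg_nnsfun_approx.
transitivity (limn (fun n => \int[nu]_x (f_ n x)%:E)).
  rewrite -monotone_convergence//.
  - by apply: eq_integral => y _; exact: fE.
  - by move=> n; exact/measurable_EFinP/measurable_funP.
  - by move=> n y _; rewrite lee_fin.
  - by move=> y _ m n mn; rewrite lee_fin; exact/lefP/nd_nnsfun_approx.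
rewrite [X in limn X](_ : _ = (fun n => \int[mu]_x ((f_ n x)%:E * (k x)%:E))).
  rewrite -monotone_convergence//; last 3 first.
    - move=> n; apply: emeasurable_funM => //.
      exact/measurable_EFinP/measurable_funP.
    - by move=> n x _; rewrite mule_ge0// lee_fin.
    - move=> x _ m n mn; apply: lee_wpmul2r; first by rewrite lee_fin.
      by rewrite lee_fin; exact/lefP/nd_nnsfun_approx.
  apply: eq_integral => x _; apply/cvg_lim => //.
  apply: cvgeZr => //.
  exact: cvg_nnsfun_approx.
apply/funext => n.
rewrite integralT_nnsfun sintegralE.
have hE x : (f_ n x)%:E * (k x)%:E = \sum_(r \in range (f_ n))
    (r%:E * ((\1_(f_ n @^-1` [set r]) x)%:E * (k x)%:E)).
  rewrite fimfunE -fsumEFin// ge0_mule_fsuml; last first.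
    by move=> r; exact: nnfun_muleindic_ge0.
  by apply: eq_fsbigr => r _; rewrite EFinM muleA.
under [RHS]eq_integral do rewrite hE.
have mpre r : measurable (f_ n @^-1` [set r]) by [].
have mind r : measurable_fun setT (fun x => (\1_(f_ n @^-1` [set r]) x)%:E * (k x)%:E).
  by apply: emeasurable_funM => //; exact/measurable_EFinP.
have ind0 r x : 0 <= (\1_(f_ n @^-1` [set r]) x)%:E * (k x)%:E.
  by rewrite mule_ge0 ?lee_fin.
have prod0 r x : 0 <= r%:E * ((\1_(f_ n @^-1` [set r]) x)%:E * (k x)%:E).
  rewrite muleA; apply: mule_ge0; last by rewrite lee_fin.
  exact: nnfun_muleindic_ge0.
rewrite ge0_integral_fsum//; last first.
  by move=> r; exact: measurable_funeM.
apply: eq_fsbigr => r; rewrite inE => -[x0 _ <-].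
rewrite ge0_integralZl//; last by rewrite lee_fin.
congr (_ * _); rewrite nuE// integral_mkcond.
apply: eq_integral => x _; rewrite patchE indicE.
by case: ifP => _; rewrite ?mul1e ?mul0e.
Qed.
End integral_density.

Section joint_law.
Local Open Scope ereal_scope.
Context {R : realType} {d dW dY : measure_display}.
Context {Omega : measurableType d} {W : measurableType dW} {Y : measurableType dY}.
Variables (P : probability Omega R) (PW : probability W R).
Variable nu : {sigma_finite_measure set Y -> \bar R}.
Variables (k : W * Y -> R) (X : {mfun Omega >-> (W * Y)%type}).
Hypotheses (k0 : forall z, (0 <= k z)%R) (mk : measurable_fun setT k).
Hypothesis lawX : forall A B, measurable A -> measurable B ->
  P (X @^-1` (A `*` B)) = \int[PW]_(w in A) \int[nu]_(y in B) (k (w, y))%:E.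

(** The law of [X] is prescribed on rectangles only; they form a generating pi-system, on which it
    agrees with the measure of density [k] with respect to [PW \x nu]. *)
Lemma integral_joint_law (f : W * Y -> \bar R) :
  measurable_fun setT f -> (forall z, 0 <= f z) ->
  \int[P]_w f (X w) = \int[PW \x nu]_z (f z * (k z)%:E).
Proof.
move=> mf f0.
have mX : measurable_fun setT X by [].
transitivity (\int[pushforward P X]_z f z).
  by rewrite ge0_integral_pushforward.
have mkE : measurable_fun setT (EFin \o k) by exact/measurable_EFinP.
apply: (ge0_integral_density k0 mk) => // C mC.
pose rect : set (set (W * Y)) :=
  [set A `*` B | A in @measurable _ W & B in @measurable _ Y].
apply: (measure_unique rect (fun=> setT) _ _ _ _ (pushforward P X)
  (density_measure_measure (PW \x nu) k0 mk)) => //.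
- exact: measurable_prod_measurableType.
- move=> _ _ [A mA [B mB <-]] [A' mA' [B' mB' <-]].
  exists (A `&` A'); first exact: measurableI.
  by exists (B `&` B'); [exact: measurableI|rewrite setXI].
- by move=> _; exists setT => //; exists setT => //; rewrite setXTT.
- by rewrite bigcup_const//; exists 0%N.
- move=> _ [A mA [B mB <-]].
  rewrite /= /pushforward lawX// /density_measure_measure/= /density_measure.
  rewrite [RHS]integral_mkcond fubini_tonelli1//; last 2 first.
  + by apply/(measurable_restrictT _ _).1 => //; [exact: measurableX|exact: measurable_funTS].
  + by move=> z; apply: erestrict_ge0 => // x _; rewrite lee_fin.
  rewrite [LHS]integral_mkcond; apply: eq_integral => w _.
  rewrite /fubini_F patchE; case: ifPn => wA.
    rewrite [LHS]integral_mkcond; apply: eq_integral => y _.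
    rewrite !patchE; congr (if _ then _ else _).
    rewrite inE in wA; apply/idP/idP; rewrite !inE; first by split.
    by case.
  rewrite integral0_eq// => y _; rewrite patchE ifF//.
  by apply/negP; rewrite inE => -[/= wA' _]; move: wA; rewrite notin_setE.
- move=> _; rewrite /= /pushforward preimage_setT.
  exact: le_lt_trans (probability_le1 P measurableT) (ltry _).
Qed.

End joint_law.

Section ge0_real_integral.
Context {R : realType} {d : measure_display} {Z : measurableType d}.
Variable M : {measure set Z -> \bar R}.
Implicit Types f g : Z -> R.

(** Bundles measurability, sign and finiteness, so that an inequality between means reduces to a
    pointwise one between non-negative real functions. *)
Definition ge0_integral_is f (a : R) : Prop :=
  [/\ measurable_fun setT f, forall z, 0 <= f z &
      (\int[M]_z (f z)%:E = a%:E)%E].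

Lemma ge0_integral_isD f g a b : ge0_integral_is f a -> ge0_integral_is g b ->
  ge0_integral_is (fun z => f z + g z) (a + b).
Proof.
move=> [mf f0 fa] [mg g0 gb]; split.
- exact: measurable_funD.
- by move=> z; rewrite addr_ge0.
- under eq_integral do rewrite EFinD.
  rewrite ge0_integralD ?fa ?gb//.
  + by move=> z _; rewrite lee_fin.
  + exact/measurable_EFinP.
  + by move=> z _; rewrite lee_fin.
  + exact/measurable_EFinP.
Qed.

Lemma ge0_integral_isZ f a k : 0 <= k -> ge0_integral_is f a ->
  ge0_integral_is (fun z => k * f z) (k * a).
Proof.
move=> k0 [mf f0 fa]; split.
- exact: measurable_funM.
- by move=> z; rewrite mulr_ge0.
- under eq_integral do rewrite EFinM.
  rewrite ge0_integralZl_EFin ?fa//.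
  + by move=> z _; rewrite lee_fin.
  + exact/measurable_EFinP.
Qed.

Lemma ge0_integral_is_le f g a b : ge0_integral_is f a -> ge0_integral_is g b ->
  (forall z, f z <= g z) -> a <= b.
Proof.
move=> [mf f0 fa] [mg g0 gb] fg; rewrite -lee_fin -fa -gb.
apply: ge0_le_integral => //.
- by move=> z _; rewrite lee_fin.
- exact/measurable_EFinP.
- exact/measurable_EFinP.
- by move=> z _; rewrite lee_fin.
Qed.

Section hellinger_control.
Variables (s r q : Z -> R) (hr hq : R).
Hypothesis r0 : forall z, 0 < r z.
Hypothesis q0 : forall z, 0 < q z.
Hypotheses (s1 : ge0_integral_is (fun z => s z ^+ 2) 1).
Hypotheses (r1 : ge0_integral_is (fun z => r z ^+ 2) 1).
Hypotheses (q1 : ge0_integral_is (fun z => q z ^+ 2) 1).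
Hypothesis shr : ge0_integral_is (fun z => (s z - r z) ^+ 2) (2 * hr).
Hypothesis shq : ge0_integral_is (fun z => (s z - q z) ^+ 2) (2 * hq).
Let f z := (q z - r z) / (q z + r z).

Let f1 z : -1 <= f z <= 1.
Proof.
have := r0 z; have := q0 z => q0z r0z.
have qr : 0 < q z + r z by exact: addr_gt0.
by rewrite /f ler_pdivlMr// ler_pdivrMr//; apply/andP; split; lra.
Qed.

Let fM z : f z * (q z + r z) = q z - r z.
Proof. by rewrite /f divfK// gt_eqF// addr_gt0. Qed.

(* With [D = s - (q + r) / 2], [f * s^2] splits as
   [((s - r)^2 - (s - q)^2) / 2 + D^2 * f + (q^2 - r^2) / 4]. *)
Lemma psi_mean_le (e : R) :
  ge0_integral_is (fun z => (1 + f z) * s z ^+ 2) (1 + e) ->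
  e <= 7 / 2 * hr - 3 / 8 * hq.
Proof.
move=> fe.
(* Negative terms are moved across so that both sides are non-negative. The quarters of [r ^+ 2] and
   [q ^+ 2] cancel after integration; [3 / 16] and [7 / 4] double because the squared gaps integrate
   to [2 * hq] and [2 * hr]. *)
have L := ge0_integral_isD (ge0_integral_isD fe
  (@ge0_integral_isZ _ _ (3 / 16) ltac:(by []) shq))
  (@ge0_integral_isZ _ _ (1 / 4) ltac:(by []) r1).
have U := ge0_integral_isD (ge0_integral_isD s1
  (@ge0_integral_isZ _ _ (7 / 4) ltac:(by []) shr))
  (@ge0_integral_isZ _ _ (1 / 4) ltac:(by []) q1).
have := ge0_integral_is_le L U; cbv beta => /(_ _) h.
suff /h : forall z, (1 + f z) * s z ^+ 2 + 3 / 16 * (s z - q z) ^+ 2 + 1 / 4 * r z ^+ 2 <=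
  s z ^+ 2 + 7 / 4 * (s z - r z) ^+ 2 + 1 / 4 * q z ^+ 2 by lra.
move=> z; have := fM z; have /andP[_ f1z] := f1 z.
move: (f z) (s z) (r z) (q z) f1z => F S Rr Q F1 FM.
pose D := S - (Q + Rr) / 2.
have -> : (1 + F) * S ^+ 2 = S ^+ 2 + D ^+ 2 * F + D * (F * (Q + Rr)) +
   (Q + Rr) * (F * (Q + Rr)) / 4 by rewrite /D; field.
rewrite FM.
have h1 : D ^+ 2 * F <= D ^+ 2 by rewrite ler_piMr// sqr_ge0.
(* [D] is half of [(S - Q) + (S - Rr)]; the unbalanced weights leave [1 / 2 - 5 / 16 = 3 / 16] of
   the negative term, against [1 / 2 + 5 / 4 = 7 / 4]. *)
have h2 : D ^+ 2 <= 5 / 16 * (S - Q) ^+ 2 + 5 / 4 * (S - Rr) ^+ 2.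
  have := sqr_ge0 ((S - Q) / 2 - 2 * (S - Rr)); rewrite /D; nra.
have h3 : D * (Q - Rr) = ((S - Rr) ^+ 2 - (S - Q) ^+ 2) / 2 by rewrite /D; field.
by rewrite h3; move: (D ^+ 2) (D ^+ 2 * F) h1 h2 => ? ? ? ?; lra.
Qed.

(** [s] is [D] plus [(q + r) / 2]: multiplication by [f] turns the second part into [(q - r) / 2]
    and does not increase the first. Both are combinations of [s - q] and [s - r]. *)
Lemma psi_sqr_mean_le (b : R) :
  ge0_integral_is (fun z => f z ^+ 2 * s z ^+ 2) b -> b <= 4 * (hr + hq).
Proof.
move=> fb.
have U := @ge0_integral_isZ _ _ 2 ltac:(by []) (ge0_integral_isD shr shq).
have := ge0_integral_is_le fb U; cbv beta => h.
suff /h : forall z, f z ^+ 2 * s z ^+ 2 <=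
  2 * ((s z - r z) ^+ 2 + (s z - q z) ^+ 2) by lra.
move=> z; have := fM z; have /andP[f1z f1z'] := f1 z.
move: (f z) (s z) (r z) (q z) f1z f1z' => F S Rr Q F1 F1' FM.
pose D := S - (Q + Rr) / 2.
have h0 : S ^+ 2 <= 2 * D ^+ 2 + (Q + Rr) ^+ 2 / 2.
  by have := sqr_ge0 (S - (Q + Rr)); rewrite /D; nra.
apply: (le_trans (ler_wpM2l (sqr_ge0 F) h0)).
have -> : F ^+ 2 * (2 * D ^+ 2 + (Q + Rr) ^+ 2 / 2) =
  2 * (F ^+ 2 * D ^+ 2) + (F * (Q + Rr)) ^+ 2 / 2 by field.
rewrite FM.
have h1 : F ^+ 2 * D ^+ 2 <= D ^+ 2.
  by rewrite ler_piMl ?sqr_ge0//; nra.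
have := sqr_ge0 ((S - Q) + (S - Rr)); have := sqr_ge0 ((S - Q) - (S - Rr)).
rewrite /D in h1 *; nra.
Qed.

End hellinger_control.
End ge0_real_integral.

(** * Clipping to the parameter interval *)

Section clip.
Context {R : realType}.
Implicit Types vm vp t : R.

Definition clip vm vp t : R := Num.min (Num.max t vm) vp.

Lemma clip_itv vm vp t : vm <= vp -> vm <= clip vm vp t <= vp.
Proof.
by move=> v; rewrite /clip le_min le_max lexx orbT v ge_min lexx orbT.
Qed.

Lemma clip_id vm vp t : vm <= t <= vp -> clip vm vp t = t.
Proof. by move=> /andP[? ?]; rewrite /clip max_l// min_l. Qed.

Lemma clip_le vm vp s t : s <= t -> clip vm vp s <= clip vm vp t.
Proof.
move=> st; rewrite /clip le_min ge_min ge_max !le_max st lexx !orbT/=.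
by rewrite ge_min lexx orbT.
Qed.

Lemma clip_lipschitz vm vp s t : `|clip vm vp s - clip vm vp t| <= `|s - t|.
Proof.
wlog st : s t / s <= t => [h|].
  by have [/h//|/ltW/h] := leP s t; rewrite distrC (distrC t).
rewrite !ler0_norm ?subr_le0 ?clip_le// !opprB /clip.
by case: (leP s vm) => ?; case: (leP t vm) => ?; case: (leP vm vp) => ?;
   case: (leP s vp) => ?; case: (leP t vp) => ?; lra.
Qed.

Lemma measurable_clip vm vp : measurable_fun setT (clip vm vp).
Proof.
apply: measurable_minr; last exact: measurable_cst.
by apply: measurable_maxr; [exact: measurable_id|exact: measurable_cst].
Qed.

Lemma cvg_clip vm vp (s : nat -> R) t : s @ \oo --> t ->
  (fun k => clip vm vp (s k)) @ \oo --> clip vm vp t.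
Proof.
move=> st; apply/cvgrPdist_le => e e0.
move/cvgrPdist_le : st => /(_ e e0); apply: filterS => k.
exact: le_trans (clip_lipschitz _ _ _ _).
Qed.

End clip.

(** * The partition function *)

Section exponential_family.
Context {R : realType} {d : measure_display} {Y : measurableType d}.
Variables (nu : {measure set Y -> \bar R}) (T : {mfun Y >-> R}) (vm vp : R).
Hypothesis v_le : vm <= vp.
Hypothesis nuT : ~ exists c : R, {ae nu, forall y, T y = c}.
Hypothesis B_fin : forall g, vm <= g <= vp ->
  (\int[nu]_y (expR (g * T y))%:E < +oo)%E.

Definition partition_function (g : R) : R :=
  fine (\int[nu]_y (expR (g * T y))%:E)%E.

Let mexp g : measurable_fun setT (fun y => expR (g * T y)).
Proof. by apply: measurableT_comp => //; exact: measurable_funM. Qed.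

Lemma partition_functionE g : vm <= g <= vp ->
  ge0_integral_is nu (fun y => expR (g * T y)) (partition_function g).
Proof.
move=> /B_fin gfin; split; [exact: mexp|by move=> y; exact: expR_ge0|].
rewrite fineK// ge0_fin_numE//; apply: integral_ge0 => y _.
by rewrite lee_fin expR_ge0.
Qed.

(** The sets [n * expR (vm * T) >= 1] cover [Y] and have finite measure by Markov's inequality. This
    makes the product [PW \x nu] and Tonelli's theorem available. *)
Lemma exponential_family_sigma_finite : sigma_finite setT nu.
Proof.
have vmI : vm <= vm <= vp by rewrite lexx.
have [_ _ Nvm] := partition_functionE vmI.
pose F (n : nat) := [set y | 1 <= n%:R * expR (vm * T y)].
have mF n : measurable (F n).
  rewrite -[F n]setTI.
  by apply: measurable_fun_le => //; exact: measurable_funM.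
exists F.
  apply/seteqP; split => // y _.
  exists (Num.truncn (expR (vm * T y))^-1).+1 => //; rewrite /F/=.
  by rewrite -ler_pdivrMr ?expR_gt0// div1r ltW// truncnS_gt.
move=> n; split => //.
apply: (@le_lt_trans _ _ (\int[nu]_y (n%:R * expR (vm * T y))%:E)%E).
  have -> : nu (F n) = (\int[nu]_y (\1_(F n) y)%:E)%E.
    by rewrite integral_indic// setIT.
  apply: ge0_le_integral => [//|y _|||y _].
  - by rewrite lee_fin.
  - exact/measurable_EFinP.
  - by apply/measurable_EFinP; exact: measurable_funM.
  - rewrite lee_fin indicE; have [|_] := boolP (y \in F n); first by rewrite inE.
    by rewrite mulr_ge0 ?expR_ge0.
have /ge0_integral_isZ/(_ (partition_functionE vmI))[_ _ ->] :
  0 <= n%:R :> R by [].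
exact: ltry.
Qed.

Let floor_exp y : R := Num.min (expR (vm * T y)) (expR (vp * T y)).

Let floor_exp_gt0 y : 0 < floor_exp y.
Proof. by rewrite lt_min !expR_gt0. Qed.

Lemma expR_itv_le (g : R) y : vm <= g <= vp ->
  Num.min (expR (vm * T y)) (expR (vp * T y)) <= expR (g * T y) <=
  expR (vm * T y) + expR (vp * T y).
Proof.
move=> /andP[g1 g2]; have e1 := expR_gt0 (vm * T y); have e2 := expR_gt0 (vp * T y).
have [T0|T0] := leP 0 (T y).
  have h1 : expR (vm * T y) <= expR (g * T y) by rewrite ler_expR ler_wpM2r.
  have h2 : expR (g * T y) <= expR (vp * T y) by rewrite ler_expR ler_wpM2r.
  by rewrite ge_min h1/=; lra.
have h1 : expR (vp * T y) <= expR (g * T y) by rewrite ler_expR ler_wnM2r// ltW.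
have h2 : expR (g * T y) <= expR (vm * T y) by rewrite ler_expR ler_wnM2r// ltW.
by rewrite ge_min h1 orbT/=; lra.
Qed.

(** The minimum of the two extreme exponentials is a positive minorant common to all [g]. If its
    integral vanished, [nu] would be null and [T] almost everywhere constant. Uniformity in [g]
    yields an integrable envelope of all densities. *)
Lemma partition_function_lower_bound : exists2 kappa : R, 0 < kappa &
  forall g, vm <= g <= vp -> kappa <= partition_function g.
Proof.
have mfl : measurable_fun setT floor_exp by apply: measurable_minr.
have vmI : vm <= vm <= vp by rewrite lexx.
pose K := (\int[nu]_y (floor_exp y)%:E)%E.
have K0 : (0 <= K)%E.
  by apply: integral_ge0 => y _; rewrite lee_fin ltW.
have Kle g : vm <= g <= vp -> (K <= (partition_function g)%:E)%E.
  move=> gI; have [_ _ <-] := partition_functionE gI.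
  apply: ge0_le_integral => //.
  - by move=> y _; rewrite lee_fin ltW.
  - exact/measurable_EFinP.
  - exact/measurable_EFinP.
  - by move=> y _; rewrite lee_fin; case/andP: (expR_itv_le y gI).
have Kfin : K \is a fin_num.
  by rewrite ge0_fin_numE// (le_lt_trans (Kle _ vmI))// ltry.
exists (fine K); last first.
  by move=> g gI; rewrite -lee_fin fineK// Kle.
rewrite lt_neqAle fine_ge0// andbT eq_sym; apply/negP => /eqP Keq0.
apply: nuT; exists 0.
have : (\int[nu]_y `|(floor_exp y)%:E| = 0)%E.
  rewrite -[RHS]/(0%:E) -Keq0 fineK//; apply: eq_integral => y _.
  by rewrite gee0_abs// lee_fin ltW.
have mflE : measurable_fun setT (fun y => (floor_exp y)%:E) by exact/measurable_EFinP.
move/(ae_eq_integral_abs nu measurableT mflE); apply: filterS => y /(_ Logic.I).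
by move=> [] /eqP; rewrite gt_eqF.
Qed.

Lemma partition_function_gt0 g : vm <= g <= vp -> 0 < partition_function g.
Proof.
by have [k k0 kle] := partition_function_lower_bound => /kle; exact: lt_le_trans.
Qed.

Lemma cvg_partition_function (g : nat -> R) (g0 : R) :
  (forall k, vm <= g k <= vp) -> vm <= g0 <= vp -> g @ \oo --> g0 ->
  (fun k => partition_function (g k)) @ \oo --> partition_function g0.
Proof.
move=> gI g0I gg0.
have vmI : vm <= vm <= vp by rewrite lexx.
have vpI : vm <= vp <= vp by rewrite lexx andbT.
have [mE E0 EE] := ge0_integral_isD (partition_functionE vmI) (partition_functionE vpI).
apply: fine_cvg.
have -> : (fine (\int[nu]_y (expR (g0 * T y))%:E))%:E = (\int[nu]_y (expR (g0 * T y))%:E)%E.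
  by have [_ _ ->] := partition_functionE g0I.
apply: (@dominated_cvg _ _ _ nu setT measurableT
  (fun k y => (expR (g k * T y))%:E) _ (fun y => (expR (vm * T y) + expR (vp * T y))%:E)).
- by move=> k; exact/measurable_EFinP.
- move=> y _; apply/fine_cvgP; split; first by near=> k.
  have gT : (fun k => g k * T y) @ \oo --> g0 * T y.
    exact: (cvgM gg0 (cvg_cst (T y))).
  exact: (cvg_comp _ _ gT (@continuous_expR R _)).
- by [].
- apply/integrableP; split; first exact/measurable_EFinP.
  under eq_integral do rewrite gee0_abs ?lee_fin//.
  by rewrite EE ltry.
- move=> k y _; rewrite gee0_abs ?lee_fin ?expR_ge0//.
  by case/andP: (expR_itv_le y (gI k)).
Unshelve. all: by end_near. Qed.

End exponential_family.

Lemma expR_convex (R : realType) (th x y : R) : 0 <= th -> th <= 1 ->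
  expR ((1 - th) * x + th * y) <= (1 - th) * expR x + th * expR y.
Proof.
have tangent (m z : R) : expR m * (1 + (z - m)) <= expR z.
  by rewrite -[z in leRHS](subrK m) expRD mulrC ler_wpM2r ?expR_ge0// expR_ge1Dx.
move=> t0 t1; set m := _ + th * y.
have := tangent m x; have := tangent m y.
have m0 : (1 - th) * (x - m) + th * (y - m) = 0 by rewrite /m; ring.
have e0 := expR_gt0 m => hy hx.
have : (1 - th) * (expR m * (1 + (x - m))) + th * (expR m * (1 + (y - m))) = expR m.
  transitivity (expR m * (1 + ((1 - th) * (x - m) + th * (y - m)))); first ring.
  by rewrite m0 addr0 mulr1.
have : (1 - th) * (expR m * (1 + (x - m))) <= (1 - th) * expR x.
  by rewrite ler_wpM2l// subr_ge0.
have : th * (expR m * (1 + (y - m))) <= th * expR y by rewrite ler_wpM2l.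
lra.
Qed.

(** * Square roots of the densities as functions of the parameter *)

Section root_density.
Context {R : realType} {d : measure_display} {Y : measurableType d}.
Variables (nu : {sigma_finite_measure set Y -> \bar R}) (T : {mfun Y >-> R}).
Variables (vm vp : R).
Hypothesis v_le : vm <= vp.
Hypothesis nuT : ~ exists c : R, {ae nu, forall y, T y = c}.
Hypothesis B_fin : forall g, vm <= g <= vp ->
  (\int[nu]_y (expR (g * T y))%:E < +oo)%E.

Local Notation cl := (clip vm vp).
Local Notation N := (partition_function nu T).

Let clI t : vm <= cl t <= vp. Proof. exact: clip_itv. Qed.

Let N0 t : 0 < N (cl t).
Proof. exact: (partition_function_gt0 v_le nuT B_fin). Qed.

(** With the clip inside, the parameter ranges over all reals and a clamped candidate is read off
    its unclamped linear predictor. *)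
Definition root_density (t : R) (y : Y) : R :=
  expR ((cl t * T y - ln (N (cl t))) / 2).

Lemma eq_root_density s t y : cl s = cl t -> root_density s y = root_density t y.
Proof. by rewrite /root_density => ->. Qed.

Lemma root_density_gt0 t y : 0 < root_density t y.
Proof. exact: expR_gt0. Qed.

Lemma root_density_sqr t y :
  root_density t y ^+ 2 = expfam_density nu T (cl t) y.
Proof. by rewrite /root_density -expRM_natl mulrC divfK. Qed.

Lemma sqrt_expfam_density t y :
  Num.sqrt (expfam_density nu T (cl t) y) = root_density t y.
Proof.
by rewrite -root_density_sqr sqrtr_sqr ger0_norm// ltW// root_density_gt0.
Qed.

Lemma root_density_sqrE t y :
  root_density t y ^+ 2 = (N (cl t))^-1 * expR (cl t * T y).
Proof.
by rewrite /root_density -expRM_natl mulrC divfK ?pnatr_eq0// expRD expRN mulrC lnK ?posrE.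
Qed.

Lemma integral_root_density_sqr t :
  ge0_integral_is nu (fun y => root_density t y ^+ 2) 1.
Proof.
under eq_fun do rewrite root_density_sqrE.
rewrite -[1](@mulVf _ (N (cl t))) ?gt_eqF//.
apply: ge0_integral_isZ; first by rewrite invr_ge0 ltW.
exact: (partition_functionE B_fin).
Qed.

Lemma measurable_log_partition : measurable_fun setT (fun t => ln (N (cl t))).
Proof.
apply: measurableT_comp => //; rewrite /partition_function.
have -> : (fun t => fine (\int[nu]_y (expR (cl t * T y))%:E)%E) =
    fine \o fubini_F nu (fun z : R * Y => (expR (cl z.1 * T z.2))%:E) by [].
apply: measurableT_comp => //.
apply: measurable_fun_fubini_tonelli_F => [|z]; last by rewrite lee_fin expR_ge0.
apply/measurable_EFinP; apply: measurableT_comp => //; apply: measurable_funM.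
  by apply: measurableT_comp => //; exact: measurable_clip.
exact: measurableT_comp.
Qed.

Lemma measurable_root_density (dW : measure_display) (W : measurableType dW)
    (g : W -> R) : measurable_fun setT g ->
  measurable_fun setT (fun z : W * Y => root_density (g z.1) z.2).
Proof.
move=> mg; have mg1 : measurable_fun setT (fun z : W * Y => g z.1).
  exact: measurableT_comp.
apply: measurableT_comp => //; apply: measurable_funM => //.
apply: measurable_funB; last exact: (measurableT_comp measurable_log_partition).
apply: measurable_funM; last exact: measurableT_comp.
by apply: measurableT_comp => //; exact: measurable_clip.
Qed.

Lemma cvg_root_density (t : nat -> R) (t0 : R) y : t @ \oo --> t0 ->
  (fun k => root_density (t k) y) @ \oo --> root_density t0 y.
Proof.
move=> tt0; have ct := @cvg_clip _ vm vp _ _ tt0.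
have Nt := cvg_partition_function v_le B_fin (fun k => clI (t k)) (clI t0) ct.
have lNt := cvg_comp _ _ Nt (continuous_ln (N0 t0)).
have ctT : (fun k => cl (t k) * T y) @ \oo --> cl t0 * T y.
  exact: (cvgM ct (cvg_cst (T y))).
have h : (fun k => (cl (t k) * T y - ln (N (cl (t k)))) / 2) @ \oo -->
    (cl t0 * T y - ln (N (cl t0))) / 2.
  apply: cvgM; last exact: cvg_cst.
  apply: cvgB; [exact: ctT|exact: lNt].
exact: (cvg_comp _ _ h (@continuous_expR R _)).
Qed.

Lemma root_density_dominated : exists2 E : Y -> R, (exists b, ge0_integral_is nu E b) &
  forall t y, root_density t y ^+ 2 <= E y.
Proof.
have vmI : vm <= vm <= vp by rewrite lexx.
have vpI : vm <= vp <= vp by rewrite lexx andbT.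
have [kappa k0 kN] := partition_function_lower_bound v_le nuT B_fin.
exists (fun y => kappa^-1 * (expR (vm * T y) + expR (vp * T y))).
  eexists; apply: ge0_integral_isZ; first by rewrite invr_ge0 ltW.
  by apply: ge0_integral_isD; exact: (partition_functionE B_fin).
move=> t y; rewrite root_density_sqrE; apply: ler_pM.
- by rewrite invr_ge0 ltW.
- exact: expR_ge0.
- by rewrite lef_pV2 ?posrE//; exact: kN.
- by case/andP: (expR_itv_le T y (clI t)).
Qed.

Local Opaque root_density clip partition_function.

(* The inverse of the density at [y] is [\int exp (t (T y' - T y)) dnu y'], a
   convex function of [t]. *)
Lemma root_density_quasi_concave r s t y : r <= s -> s <= t ->
  Num.min (root_density r y) (root_density t y) <= root_density s y.
Proof.
move=> rs st.
(* When the clipped endpoints coincide the three densities are equal; otherwise the denominator of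
   [th] is positive. *)
have [e|rt] := eqVneq (cl r) (cl t).
  have cs : cl s = cl r.
    by apply/le_anti; rewrite (clip_le vm vp rs) andbT e (clip_le vm vp st).
  have -> : root_density s y = root_density r y by exact: eq_root_density.
  rewrite ge_min.
  apply/orP; left.
  exact: lexx.
pose g0 := cl r; pose g := cl s; pose g1 := cl t.
have g0g : g0 <= g by exact: clip_le.
have gg1 : g <= g1 by exact: clip_le.
have g01 : 0 < g1 - g0.
  by rewrite subr_gt0 lt_neqAle rt/=; exact: le_trans gg1.
pose th := (g - g0) / (g1 - g0).
have th0 : 0 <= th by apply: divr_ge0; [rewrite subr_ge0|exact: ltW].
have th1 : th <= 1 by rewrite /th ler_pdivrMr// mul1r lerD2r gg1.
have gE : g = (1 - th) * g0 + th * g1.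
  have -> : (1 - th) * g0 + th * g1 = g0 + th * (g1 - g0) by ring.
  by rewrite /th divfK ?gt_eqF// addrC subrK.
have J u : ge0_integral_is nu (fun y' => expR (- (cl u * T y)) * expR (cl u * T y'))
    (expR (- (cl u * T y)) * N (cl u)).
  by apply: ge0_integral_isZ; [exact: expR_ge0|exact: (partition_functionE B_fin)].
have JE u : expR (- (cl u * T y)) * N (cl u) = (root_density u y ^+ 2)^-1.
  by rewrite root_density_sqrE expRN invfM invrK mulrC.
have th1' : 0 <= 1 - th by rewrite subr_ge0.
have h : expR (- (g * T y)) * N g <=
    (1 - th) * (expR (- (g0 * T y)) * N g0) + th * (expR (- (g1 * T y)) * N g1).
  apply: (ge0_integral_is_le (J s)
    (ge0_integral_isD (ge0_integral_isZ th1' (J r)) (ge0_integral_isZ th0 (J t)))).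
  move=> y'; cbv beta; rewrite -/g -/g0 -/g1 -!expRD.
  have -> : - (g * T y) + g * T y' = (1 - th) * (- (g0 * T y) + g0 * T y') +
    th * (- (g1 * T y) + g1 * T y') by rewrite {1 2}gE; ring.
  exact: expR_convex.
rewrite (JE s) (JE r) (JE t) in h.
move: h (root_density_gt0 s y) (root_density_gt0 r y) (root_density_gt0 t y).
move: (root_density s y) (root_density r y) (root_density t y) => a b c.
(* If [a] were below both [b] and [c], its inverse square would strictly exceed both of theirs,
   hence their barycentre. *)
move=> h a0 b0 c0; rewrite leNgt lt_min; apply/negP => /andP[ab ac].
have inv_lt u : a < u -> (u ^+ 2)^-1 < (a ^+ 2)^-1.
  move=> au; have u0 := lt_trans a0 au.
  by rewrite ltf_pV2 ?posrE ?exprn_gt0// ltr_sqr ?nnegrE ?(ltW a0) ?(ltW u0).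
have := inv_lt _ ac; have := inv_lt _ ab.
move: ((a ^+ 2)^-1) ((b ^+ 2)^-1) ((c ^+ 2)^-1) h => A B C h BA CA.
have : (1 - th) * (A - B) + th * (A - C) <= 0 by lra.
rewrite leNgt => /negP; apply.
have [->|th00] := eqVneq th 0; first by rewrite subr0 mul1r mul0r addr0 subr_gt0.
apply: ltr_wpDl; first by rewrite mulr_ge0// subr_ge0 ltW.
by rewrite mulr_gt0 ?subr_gt0// lt_neqAle eq_sym th00.
Qed.

End root_density.

Lemma sqrt_density_diff (R : rcfType) (s t x : R) : 0 <= s -> 0 <= t -> 0 <= x ->
  (Num.sqrt (s ^+ 2 * x) - Num.sqrt (t ^+ 2 * x)) ^+ 2 = (s - t) ^+ 2 * x.
Proof.
move=> s0 t0 x0; rewrite (@sqrtrM _ (s ^+ 2)) ?sqr_ge0// (@sqrtrM _ (t ^+ 2)) ?sqr_ge0//.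
rewrite !sqrtr_sqr !ger0_norm//.
by rewrite -mulrBl exprMn sqr_sqrtr.
Qed.

(** * Hellinger distance between conditional distributions *)

Section conditional_model.
Context {R : realType} {d dW : measure_display} {Y : measurableType d}.
Context {W : measurableType dW}.
Variables (PW : probability W R) (nu : {sigma_finite_measure set Y -> \bar R}).
Variables (T : {mfun Y >-> R}) (vm vp : R).
Hypothesis v_le : vm <= vp.
Hypothesis nuT : ~ exists c : R, {ae nu, forall y, T y = c}.
Hypothesis B_fin : forall g, vm <= g <= vp ->
  (\int[nu]_y (expR (g * T y))%:E < +oo)%E.
Implicit Types g : W -> R.

Local Notation cl := (clip vm vp).
Local Notation rd := (root_density nu T vm vp).
Local Notation M := (PW \x nu)%E.
Local Opaque root_density clip partition_function.

Let mrd g : measurable_fun setT g ->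
  measurable_fun setT (fun z : W * Y => rd (g z.1) z.2).
Proof. exact: measurable_root_density. Qed.

Lemma integral_cond_density g : measurable_fun setT g ->
  ge0_integral_is M (fun z => rd (g z.1) z.2 ^+ 2) 1.
Proof.
move=> mg; split.
- by apply: measurable_funX; exact: mrd.
- by move=> z; exact: sqr_ge0.
- rewrite fubini_tonelli1//; last 2 first.
  + by apply/measurable_EFinP/measurable_funX; exact: mrd.
  + by move=> z; rewrite lee_fin sqr_ge0.
  have E w : fubini_F nu (fun z : W * Y => (rd (g z.1) z.2 ^+ 2)%:E) w = 1%E.
    by have [_ _] := integral_root_density_sqr v_le nuT B_fin (g w).
  under eq_integral do rewrite E.
  by rewrite integral_cst// [X in (_ * X)%E]probability_setT mule1.
Qed.

Let sqr_gap g g' (z : W * Y) : R := (rd (g z.1) z.2 - rd (g' z.1) z.2) ^+ 2.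

Definition hell2 g g' : R := fine (\int[M]_z (sqr_gap g g' z)%:E)%E / 2.

Let msqr_gap g g' : measurable_fun setT g -> measurable_fun setT g' ->
  measurable_fun setT (sqr_gap g g').
Proof.
by move=> mg mg'; apply: measurable_funX; apply: measurable_funB; exact: mrd.
Qed.

Lemma ge0_integral_is_dominated (f E : W * Y -> R) b : measurable_fun setT f ->
  (forall z, 0 <= f z <= E z) -> ge0_integral_is M E b ->
  ge0_integral_is M f (fine (\int[M]_z (f z)%:E)%E).
Proof.
move=> mf fE [mE E0 EE].
have f0 z : 0 <= f z by case/andP: (fE z).
split => //; rewrite fineK// ge0_fin_numE; last first.
  by apply: integral_ge0 => z _; rewrite lee_fin.
apply: le_lt_trans (ltry b); rewrite -EE; apply: ge0_le_integral_nonmeas => z.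
  by rewrite lee_fin.
by rewrite lee_fin; case/andP: (fE z).
Qed.

Lemma hell2_integral g g' : measurable_fun setT g -> measurable_fun setT g' ->
  ge0_integral_is M (fun z => (rd (g z.1) z.2 - rd (g' z.1) z.2) ^+ 2)
    (2 * hell2 g g').
Proof.
move=> mg mg'; rewrite /hell2 mulrC divfK ?pnatr_eq0//.
apply: (ge0_integral_is_dominated (msqr_gap mg mg') _ (ge0_integral_isD
  (@ge0_integral_isZ _ _ _ _ _ _ 2 ltac:(by []) (integral_cond_density mg))
  (@ge0_integral_isZ _ _ _ _ _ _ 2 ltac:(by []) (integral_cond_density mg')))).
move=> z; rewrite /sqr_gap sqr_ge0/=; move: (rd _ _) (rd _ _) => s t.
by have := sqr_ge0 (s + t); lra.
Qed.

Lemma hell2_ge0 g g' : measurable_fun setT g -> measurable_fun setT g' ->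
  0 <= hell2 g g'.
Proof.
move=> mg mg'; rewrite /hell2 divr_ge0// fine_ge0//.
by apply: integral_ge0 => z _; rewrite lee_fin sqr_ge0.
Qed.

(** Serves to pass from rational to real coefficients. All squared root densities lie below one
    integrable [E], so each squared gap is below [4 * E] and convergence is dominated. *)
Lemma hell2_cvg g g' (gk : nat -> W -> R) : measurable_fun setT g ->
  measurable_fun setT g' -> (forall k, measurable_fun setT (gk k)) ->
  (forall w, (fun k => gk k w) @ \oo --> g' w) ->
  (fun k => hell2 g (gk k)) @ \oo --> hell2 g g'.
Proof.
move=> mg mg' mgk gkg'.
apply: cvgM; last exact: cvg_cst.
have [E [b Eb] rdE] := root_density_dominated v_le nuT B_fin.
have [mE E0 EE] := Eb.
have ME : ge0_integral_is M (fun z => 4 * E z.2) (4 * b).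
  apply: ge0_integral_isZ; first by [].
  split; [exact: measurableT_comp|by []|].
  rewrite fubini_tonelli1//; last 2 first.
  - by apply/measurable_EFinP; exact: measurableT_comp.
  - by move=> z; rewrite lee_fin.
  rewrite /fubini_F/=; under eq_integral do rewrite EE.
  by rewrite integral_cst// [X in (_ * X)%E]probability_setT mule1.
have [mME ME0 MEE] := ME.
have gapE h h' z : sqr_gap h h' z <= 4 * E z.2.
  have := rdE (h z.1) z.2; have := rdE (h' z.1) z.2; rewrite /sqr_gap.
  by move: (rd _ _) (rd _ _) => s t; have := sqr_ge0 (s + t); lra.
apply: fine_cvg.
have -> : (fine (\int[M]_z (sqr_gap g g' z)%:E))%:E = (\int[M]_z (sqr_gap g g' z)%:E)%E.
  have side z : 0 <= sqr_gap g g' z <= 4 * E z.2 by rewrite sqr_ge0/=.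
  by have [_ _ ->] := ge0_integral_is_dominated (msqr_gap mg mg') side ME.
apply: (@dominated_cvg _ _ _ M setT measurableT
  (fun k z => (sqr_gap g (gk k) z)%:E) _ (fun z => (4 * E z.2)%:E)).
- by move=> k; apply/measurable_EFinP; exact: msqr_gap.
- move=> z _; apply/fine_cvgP; split; first by near=> k.
  have c : (fun k => rd (gk k z.1) z.2) @ \oo --> rd (g' z.1) z.2.
    by apply: cvg_root_density => //; exact: gkg'.
  have c1 : (fun k => rd (g z.1) z.2 - rd (gk k z.1) z.2) @ \oo -->
    rd (g z.1) z.2 - rd (g' z.1) z.2.
    by apply: cvgB; [exact: cvg_cst|exact: c].
  exact: (cvg_comp _ _ c1 (@exprn_continuous R 2 _)).
- by [].
- apply/integrableP; split; first exact/measurable_EFinP.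
  under eq_integral do rewrite gee0_abs ?lee_fin//.
  by rewrite MEE ltry.
- by move=> k z _; rewrite gee0_abs ?lee_fin ?sqr_ge0//; exact: gapE.
Unshelve. all: by end_near. Qed.

Section hellinger_distance.
Variables (mu : {measure set Y -> \bar R}) (a : {mfun Y >-> R}).
Hypothesis a0 : forall y, 0 <= a y.
Hypothesis nuE : forall A, measurable A -> nu A = (\int[mu]_(y in A) (a y)%:E)%E.

(** The factor [a] comes out of both square roots, which turns the [mu]-integral into a
    [nu]-integral; Tonelli merges it with [PW]. *)
Lemma cond_hellinger2E g g' : measurable_fun setT g -> measurable_fun setT g' ->
  cond_hellinger2 mu PW (expfam_cond nu a T (cl \o g)) (expfam_cond nu a T (cl \o g'))
  = (hell2 g g')%:E.
Proof.
move=> mg mg'; rewrite /cond_hellinger2.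
have mrdw (h : W -> R) w : measurable_fun setT h -> measurable_fun setT (fun y => rd (h w) y).
  by move=> mh; exact: (measurable_fun_pair2 w (mrd mh)).
have [_ _ HE] := hell2_integral mg mg'.
transitivity (2^-1%:E * \int[M]_z (sqr_gap g g' z)%:E)%E; last first.
  by rewrite HE -EFinM mulKf// pnatr_eq0.
rewrite fubini_tonelli1; last 2 first.
- by apply/measurable_EFinP; exact: msqr_gap.
- by move=> z; rewrite lee_fin sqr_ge0.
rewrite -ge0_integralZl_EFin//; last 2 first.
- by move=> w _; apply: integral_ge0 => y _; rewrite lee_fin sqr_ge0.
- apply: measurable_fun_fubini_tonelli_F => [|z]; last by rewrite lee_fin sqr_ge0.
  by apply/measurable_EFinP; exact: msqr_gap.
apply: eq_integral => w _; rewrite /fubini_F.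
have Iw : ge0_integral_is nu (fun y => (rd (g w) y - rd (g' w) y) ^+ 2)
    (fine (\int[nu]_y ((rd (g w) y - rd (g' w) y) ^+ 2)%:E)%E).
  split; last 2 first.
  - by move=> y; exact: sqr_ge0.
  - rewrite fineK// ge0_fin_numE; last first.
      by apply: integral_ge0 => y _; rewrite lee_fin sqr_ge0.
    have [_ _ U] := ge0_integral_isD
      (@ge0_integral_isZ _ _ _ _ _ _ 2 ltac:(by [])
        (integral_root_density_sqr v_le nuT B_fin (g w)))
      (@ge0_integral_isZ _ _ _ _ _ _ 2 ltac:(by [])
        (integral_root_density_sqr v_le nuT B_fin (g' w))).
    apply: le_lt_trans (ltry (2 * 1 + 2 * 1)); rewrite -U.
    apply: ge0_le_integral_nonmeas => y; rewrite lee_fin ?sqr_ge0//.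
    by move: (rd _ _) (rd _ _) => s t; have := sqr_ge0 (s + t); lra.
  by apply: measurable_funX; apply: measurable_funB; exact: mrdw.
have [mI I0 IE] := Iw.
rewrite /sqr_gap/= IE -EFinM; congr (_%:E).
rewrite /hellinger sqr_sqrtr; last first.
  by rewrite mulr_ge0// Rintegral_ge0// => y _; exact: sqr_ge0.
congr (_ * _); rewrite /Rintegral; congr fine.
have ma : measurable_fun setT a by [].
rewrite (ge0_integral_density a0 ma nuE (f := fun y => ((rd (g w) y - rd (g' w) y) ^+ 2)%:E));
  [|exact/measurable_EFinP|by move=> y; rewrite lee_fin].
have E y : (Num.sqrt (expfam_cond nu a T (cl \o g) w y) -
    Num.sqrt (expfam_cond nu a T (cl \o g') w y)) ^+ 2 =
    (rd (g w) y - rd (g' w) y) ^+ 2 * a y.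
  have e h : expfam_cond nu a T (cl \o h) w y = rd (h w) y ^+ 2 * a y.
    by rewrite /expfam_cond root_density_sqr.
  rewrite (e g) (e g'); apply: sqrt_density_diff => //;
    by apply: ltW; exact: root_density_gt0.
by apply: eq_integral => y _; rewrite E EFinM.
Qed.

End hellinger_distance.
End conditional_model.

Lemma model_pen_ge (R : realType) (p n : nat) (m : {set 'I_p})
    (V := (vc_bound m)%:R : R) :
  10 ^+ 4 * (V * (1 + log_plus (n%:R / V))) + 10 ^+ 2 * 4 * weight R m <=
  model_pen n (weight R) m.
Proof.
rewrite /model_pen /model_dim -/V.
have V0 : 0 <= V by rewrite ler0n.
have : 0 <= V * log_plus (n%:R / V) by rewrite mulr_ge0// log_plus_ge0.
have := weight_ge0 (R := R) m.
move: (log_plus _) (weight R m) => l D D0 l0; lra.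
Qed.

Lemma model_pen_ge0 (R : realType) (p n : nat) (m : {set 'I_p}) :
  0 <= model_pen n (weight R) m.
Proof.
rewrite /model_pen /model_dim; apply: mulr_ge0; first exact: exprn_ge0.
apply: addr_ge0; last by apply: mulr_ge0; [lra|exact: weight_ge0].
apply: mulr_ge0; first by rewrite mulr_ge0// exprn_ge0.
by have := log_plus_ge0 (n%:R / (vc_bound m)%:R : R); lra.
Qed.

(** * Union over all models *)

Section all_models_sup.
Context {R : realType} {n p : nat}.
Variables (v : 'I_n * bool -> 'I_p -> R) (phi : 'I_n * bool -> R -> R).
Hypothesis phi1 : forall k t, `|phi k t| <= 1.
Hypothesis phiq : forall k r s t, r <= s -> s <= t ->
  Num.min (phi k r) (phi k t) <= phi k s.

Lemma all_models_sup_bound : exists G : {set 'I_n} -> R,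
  [/\ forall e, 0 <= G e,
      forall e (m : {set 'I_p}) (c : 'I_p -> rat),
        (forall j, j \notin m -> c j = 0) ->
        offset_process (fun k => phi k (\sum_j ratr (c j) * v k j)) e -
          model_pen n (weight R) m <= G e &
      \sum_e G e <= 2 ^+ n * 512].
Proof.
pose co (c : 'I_p -> rat) j : R := ratr (c j).
have step (m : {set 'I_p}) : exists G : {set 'I_n} -> R,
  [/\ forall e, 0 <= G e,
      forall e c, (forall j, j \notin m -> c j = 0) ->
        offset_process (fun k => phi k (\sum_j co c j * v k j)) e -
          model_pen n (weight R) m <= G e &
      \sum_e G e <= 2 ^+ n * (256 * expR (- ((vc_bound m)%:R + weight R m)))].
  apply: (@model_sup_bound R n p _ v phi m co
    [set c | forall j, j \notin m -> c j = 0] (fun=> 0)) => //.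
  - exact: weight_ge0.
  - exact: model_pen_ge.
  - by move=> c /= cm j jm; rewrite /co cm// raddf0.
have [G GP] : {G : {set 'I_p} -> {set 'I_n} -> R & forall m,
  [/\ forall e, 0 <= G m e,
      forall e c, (forall j, j \notin m -> c j = 0) ->
        offset_process (fun k => phi k (\sum_j co c j * v k j)) e -
          model_pen n (weight R) m <= G m e &
      \sum_e G m e <= 2 ^+ n * (256 * expR (- ((vc_bound m)%:R + weight R m)))]}.
  exact: (boolp.choice step).
have G0 m e : 0 <= G m e by have [] := GP m.
(* The supremum over models is bounded by a sum; [512] is [256] times the total weight 2. *)
exists (fun e => \sum_m G m e); split.
- by move=> e; apply: sumr_ge0.
- move=> e m c cm; have [_ /(_ e c cm) h _] := GP m.
  apply: (le_trans h); rewrite (bigD1 m)//= lerDl.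
  by apply: sumr_ge0.
- rewrite exchange_big/=.
  apply: (@le_trans _ _ (\sum_m 2 ^+ n *
    (256 * expR (- ((vc_bound m)%:R + weight R (m : {set 'I_p})))))).
    by apply: ler_sum => m _; have [] := GP m.
  rewrite -!mulr_sumr; apply: ler_wpM2l; first exact: exprn_ge0.
  by have := @sum_weights_le R p; lra.
Qed.

End all_models_sup.

Section model_enumeration.
Context {R : realType} {p : nat}.

(** Numbers that code nothing fall back on the empty model. A function recurs with every model
    supporting its coefficients. *)
Definition model_code (k : nat) : {set 'I_p} * {ffun 'I_p -> rat} :=
  odflt (finset.set0, [ffun=> 0]) (unpickle k).

Definition model_nth (k : nat) : {set 'I_p} := (model_code k).1.

Definition coef_nth (k : nat) (j : 'I_p) : rat :=
  if j \in model_nth k then (model_code k).2 j else 0.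

Lemma coef_nth_supp k j : j \notin model_nth k -> coef_nth k j = 0.
Proof. by rewrite /coef_nth => /negbTE ->. Qed.

Lemma model_nth_surj (m : {set 'I_p}) (c : 'I_p -> rat) :
  (forall j, j \notin m -> c j = 0) ->
  exists k, model_nth k = m /\ coef_nth k = c.
Proof.
move=> cm; exists (pickle (m, [ffun j => c j])).
rewrite /coef_nth /model_nth /model_code pickleK/=; split => //.
apply/funext => j; rewrite ffunE.
by case: ifPn => // /cm ->.
Qed.

End model_enumeration.

(** * Properties of the estimator *)

Lemma psi_sqrt_ratio (R : realType) (q r : R) : 0 < q -> 0 < r ->
  psi (sqrte (density_ratio q r)) =
  (Num.sqrt q - Num.sqrt r) / (Num.sqrt q + Num.sqrt r).
Proof.
move=> q0 r0; rewrite /density_ratio gt_eqF//=.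
rewrite sqrtrM ?ltW// sqrtrV ?ltW//.
have r0' : 0 < Num.sqrt r by rewrite sqrtr_gt0.
have q0' : 0 < Num.sqrt q by rewrite sqrtr_gt0.
by field; rewrite !gt_eqF// addr_gt0.
Qed.

Section estimator.
Context {R : realType} {p n : nat} {WW : set (p.-tuple R)} {hW : WW !=set0}.
Context {d : measure_display} {Y : measurableType d}.
Variables (nu : {measure set Y -> \bar R}) (T : Y -> R) (vm vp : R).
Local Notation W := (covariate_space hW).
Local Notation MM := (all_models p).
Local Notation pen := (penalty (n := n) vm vp MM (weight R)).
Local Notation test := (test_stat nu T).
Local Notation ups := (upsilon nu T vm vp MM (weight R)).
Local Notation GU := (Gamma_union hW vm vp MM).
Implicit Types g : W -> R.

Lemma Gamma_unionP g : GU g <-> exists m, Gamma hW vm vp m g.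
Proof.
split=> [[m _ mg]|[m mg]]; first by exists m.
by exists m => //=; rewrite /all_models finset.in_setT.
Qed.

(** There are finitely many models, so the infimum is attained at a model that contains [g]. *)
Lemma penaltyP g m0 : Gamma hW vm vp m0 g -> exists m,
  [/\ Gamma hW vm vp m g, pen g = model_pen n (weight R) m &
      model_pen n (weight R) m <= model_pen n (weight R) m0].
Proof.
move=> m0g.
pose F (m : {set 'I_p}) : R := model_dim R n m + 47 / 10 * weight R m.
pose Q (m : {set 'I_p}) : bool := `[< Gamma hW vm vp m g >].
have Qm0 : Q m0 by exact/asboolP.
have [m /asboolP Qm mmin] := @Order.TotalTheory.arg_minP _ _ _ m0 Q F Qm0.
exists m; split => //; last first.
  by rewrite /model_pen ler_wpM2l ?exprn_ge0//; exact: mmin.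
rewrite /penalty /model_pen; congr (_ * _).
set S := [set _ | _ in _].
have lbS : lbound S (F m).
  by move=> _ [m' [_ m'g] <-]; apply: mmin; exact/asboolP.
have Sm : S (F m) by exists m => //; split => //; rewrite /all_models finset.in_setT.
apply/le_anti/andP; split.
  by apply: ge_inf => //; exists (F m).
by apply: lb_le_inf => //; exists (F m).
Qed.

Let expfam_density_gt0 g w y : 0 < expfam_density nu T (g w) y.
Proof. exact: expR_gt0. Qed.

Lemma test_statE (x : n.-tuple (W * Y)%type) g g' : test x g g' =
  \sum_(i < n) (Num.sqrt (expfam_density nu T (g' (tnth x i).1) (tnth x i).2) -
                Num.sqrt (expfam_density nu T (g (tnth x i).1) (tnth x i).2)) /
               (Num.sqrt (expfam_density nu T (g' (tnth x i).1) (tnth x i).2) +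
                Num.sqrt (expfam_density nu T (g (tnth x i).1) (tnth x i).2)).
Proof.
by rewrite /test_stat; apply: eq_bigr => i _; rewrite psi_sqrt_ratio.
Qed.

Lemma test_stat_antisym (x : n.-tuple (W * Y)%type) g g' : test x g g' = - test x g' g.
Proof.
have anti (s t : R) : (s - t) / (s + t) = - ((t - s) / (t + s)).
  by rewrite -mulNr opprB (addrC t).
by rewrite !test_statE -sumrN; apply: eq_bigr => i _; exact: anti.
Qed.

Lemma test_stat_le (x : n.-tuple (W * Y)%type) g g' : test x g g' <= n%:R.
Proof.
rewrite test_statE; apply: (@le_trans _ _ (\sum_(i < n) 1)); last first.
  by rewrite sumr_const card_ord lexx.
apply: ler_sum => i _.
have le1 (s t : R) : 0 < s -> 0 < t -> (s - t) / (s + t) <= 1.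
  by move=> s0 t0; rewrite ler_pdivrMr ?addr_gt0//; lra.
by apply: le1; rewrite sqrtr_gt0 expfam_density_gt0.
Qed.

Lemma penalty_ge0 g : GU g -> 0 <= pen g.
Proof.
by move/Gamma_unionP => [m /penaltyP[m' [_ -> _]]]; exact: model_pen_ge0.
Qed.

Let ups_sup (x : n.-tuple (W * Y)%type) g : has_ubound [set test x g g' - pen g' | g' in GU].
Proof.
exists n%:R => _ [g' g'U <-].
have := test_stat_le x g g'; have := penalty_ge0 g'U.
by move: (test x g g') (pen g') => a b; lra.
Qed.

Lemma upsilon_ge (x : n.-tuple (W * Y)%type) g g' : GU g' ->
  test x g g' - pen g' + pen g <= ups x g.
Proof.
by move=> g'U; rewrite /upsilon lerD2r; apply: ub_le_sup => //; exists g'.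
Qed.

(** [upsilon] at [g] is at least the term of [g0] in its supremum, and at most [upsilon] at [g0]
    plus one, which [S] controls; antisymmetry expresses both through [test x g0]. *)
Lemma estimator_le (x : n.-tuple (W * Y)%type) g g0 (S : R) : GU g -> GU g0 ->
  ups x g <= inf [set ups x g' | g' in GU] + 1 ->
  (forall g', GU g' -> test x g0 g' - pen g' <= S) ->
  pen g <= S + test x g0 g + 2 * pen g0 + 1.
Proof.
move=> gU g0U ug gS.
have h1 := upsilon_ge x g g0U.
have h2 : inf [set ups x g' | g' in GU] <= ups x g0.
  apply: ge_inf; last by exists g0.
  (* The term [test x g' g' = 0] makes [upsilon] non-negative, so the infimum is a genuine one. *)
  exists 0 => _ [g' g'U <-].
  have := upsilon_ge x g' g'U; have := test_stat_antisym x g' g'.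
  by move: (test x g' g') (pen g') (ups x g') => a b c; lra.
have h3 : ups x g0 <= S + pen g0.
  rewrite /upsilon lerD2r; apply: ge_sup; last by move=> _ [g' g'U <-]; exact: gS.
  by exists (test x g0 g0 - pen g0); exists g0.
have := test_stat_antisym x g g0; move: h1 h2 h3 ug.
by move: (test x g g0) (test x g0 g) (pen g0) (pen g) (ups x g) (ups x g0) (inf _)
  => a b c e f h i; lra.
Qed.

End estimator.

(** * Oracle inequality *)

Lemma measurable_linear_fun (R : realType) (p : nat) (WW : set (p.-tuple R))
    (hW : WW !=set0) (c : 'I_p -> R) : measurable_fun setT (@linear_fun R p WW hW c).
Proof.
rewrite /linear_fun; apply: measurable_sum => j; apply: measurable_funM => //.
have mc : measurable_fun setT (@covariates R p WW hW).
  move=> _ A mA; rewrite setTI; exists A => //; by rewrite setTI.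
exact: (measurableT_comp (measurable_tnth j) mc).
Qed.

(** The change of law is stated for non-negative integrands; the shift by 1 brings [f] into its
    scope. *)
Lemma ge0_integral_sub1 (R : realType) (d : measure_display)
    (S : measurableType d) (P : probability S R) (f : S -> R) (a : R) :
  measurable_fun setT f -> (forall w, `|f w| <= 1) ->
  (\int[P]_w (1 + f w)%:E = a%:E)%E -> (\int[P]_w (f w)%:E = (a - 1)%:E)%E.
Proof.
move=> mf f1 fa.
have i1 : P.-integrable setT (EFin \o (fun w => 1 + f w)).
  apply: (@le_bounded_integrable _ _ _ _ _ 2); first exact: measurable_funD.
  by move=> w; apply: (le_trans (ler_normD _ _)); rewrite normr1; have := f1 w; lra.
have i2 : P.-integrable setT (EFin \o cst (1 : R)).
  exact: finite_measure_integrable_cst.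
transitivity (\int[P]_w ((1 + f w)%:E - (cst (1 : R) w)%:E))%E.
  by apply: eq_integral => w _; rewrite -EFinB/= addrAC subrr add0r.
have c1 : (\int[P]_w (cst (1 : R) w)%:E = 1)%E.
  rewrite (_ : (fun w => _) = cst 1%E)//.
  by rewrite integral_cst// [X in (_ * X)%E]probability_setT mule1.
by rewrite integralB_EFin// fa c1 EFinB.
Qed.

Lemma oracle_arith (R : realFieldType) (N H h q z : R) : 0 < N ->
  43 / 200 * (N * H) <= 183 / 25 * (N * h) + (2 * q + 1) + 2 * z ->
  H <= (183 / 25 * h + (2 * q + 1) / N) / (43 / 200) + 2 / N / (43 / 200) * z.
Proof.
move=> N0 hH.
have -> : (183 / 25 * h + (2 * q + 1) / N) / (43 / 200) + 2 / N / (43 / 200) * z =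
    (183 / 25 * (N * h) + (2 * q + 1) + 2 * z) / (43 / 200 * N).
  by field; rewrite gt_eqF.
by rewrite ler_pdivlMr; [lra|rewrite mulr_gt0//; lra].
Qed.

Section oracle.
Context {R : realType} {p n : nat} {WW : set (p.-tuple R)} {hW : WW !=set0}.
Hypothesis n_gt0 : (0 < n)%N.
Variable PW : probability (covariate_space hW) R.
Context {dY : measure_display} {Y : measurableType dY}.
Variables (mu : {measure set Y -> \bar R}).
Variables (nu : {sigma_finite_measure set Y -> \bar R}).
Variables (a : {mfun Y >-> R}) (T : {mfun Y >-> R}) (vm vp : R).
Hypothesis a0 : forall y, 0 <= a y.
Hypothesis nuE : forall A, measurable A -> nu A = (\int[mu]_(y in A) (a y)%:E)%E.
Hypothesis nuT : ~ exists c : R, {ae nu, forall y, T y = c}.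
Hypothesis v_le : vm <= vp.
Hypothesis B_fin : forall g, vm <= g <= vp ->
  (\int[nu]_y (expR (g * T y))%:E < +oo)%E.
Variable gs : covariate_space hW -> R.
Hypothesis mgs : measurable_fun setT gs.
Hypothesis gsI : forall w, vm <= gs w <= vp.
Context {d : measure_display} {Omega : measurableType d}.
Variable P : probability Omega R.
Local Notation W := (covariate_space hW).
Variable X : 'I_n -> {mfun Omega >-> (W * Y)%type}.
Hypothesis indepX : mutually_independent P (fun i => X i : Omega -> _).
Hypothesis lawX : forall i, has_conditional_law P (X i) PW
  (fun w => expfam nu T (gs w)).
Variable ghat : n.-tuple (W * Y)%type -> W -> R.
Hypothesis ghatP : is_estimator nu T vm vp (all_models p) (weight R) ghat.
Variables (m0 : {set 'I_p}) (c0 : 'I_p -> rat).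
Hypothesis c0m : forall j, j \notin m0 -> c0 j = 0.

Local Notation cl := (clip vm vp).
Local Notation rd := (root_density nu T vm vp).
Local Notation M := (PW \x nu)%E.
Local Notation GU := (Gamma_union hW vm vp (all_models p)).
Local Notation hell := (hell2 PW nu T vm vp).
Local Opaque root_density clip partition_function.

Let rat_lin (c : 'I_p -> rat) : W -> R := linear_fun (fun j => ratr (c j)).

Let mlin c : measurable_fun setT (rat_lin c).
Proof. exact: measurable_linear_fun. Qed.

Let clgs : cl \o gs = gs.
Proof. by apply/funext => w /=; rewrite clip_id. Qed.

Let k (z : W * Y) : R := rd (gs z.1) z.2 ^+ 2.

Let mk : measurable_fun setT k.
Proof. by apply: measurable_funX; exact: measurable_root_density. Qed.

Let k0 z : 0 <= k z. Proof. exact: sqr_ge0. Qed.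

Let law_rect i A B : measurable A -> measurable B ->
  (P (X i @^-1` (A `*` B)) = \int[PW]_(w in A) \int[nu]_(y in B) (k (w, y))%:E)%E.
Proof.
move=> mA mB; have [_ ->//] := lawX i.
apply: eq_integral => w _; apply: eq_integral => y _.
by rewrite /k root_density_sqr/= clip_id.
Qed.

Let integral_law i (f : W * Y -> \bar R) : measurable_fun setT f ->
  (forall z, 0 <= f z)%E -> (\int[P]_w f (X i w) = \int[M]_z (f z * (k z)%:E))%E.
Proof. exact: (integral_joint_law k0 mk (@law_rect i)). Qed.

Let f (g g0 : W -> R) (z : W * Y) : R :=
  (rd (g z.1) z.2 - rd (g0 z.1) z.2) / (rd (g z.1) z.2 + rd (g0 z.1) z.2).

Let ratio_le1 (s t : R) : 0 < s -> 0 < t -> `|(s - t) / (s + t)| <= 1.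
Proof.
move=> s0 t0; rewrite ler_norml ler_pdivlMr ?ler_pdivrMr ?addr_gt0//.
by apply/andP; split; lra.
Qed.

Let f1 g g0 z : `|f g g0 z| <= 1.
Proof. by apply: ratio_le1; exact: root_density_gt0. Qed.

Let mf g g0 : measurable_fun setT g -> measurable_fun setT g0 ->
  measurable_fun setT (f g g0).
Proof.
move=> mg mg0.
have m1 : measurable_fun setT (fun z : W * Y => rd (g z.1) z.2).
  exact: measurable_root_density.
have m2 : measurable_fun setT (fun z : W * Y => rd (g0 z.1) z.2).
  exact: measurable_root_density.
have m3 : measurable_fun setT (fun z : W * Y => ln (rd (g z.1) z.2 + rd (g0 z.1) z.2)).
  exact: (measurableT_comp (@measurable_ln R) (measurable_funD m1 m2)).
have -> : f g g0 = fun z => (rd (g z.1) z.2 - rd (g0 z.1) z.2) *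
    expR (- ln (rd (g z.1) z.2 + rd (g0 z.1) z.2)).
  apply/funext => z; rewrite /f expRN lnK// posrE addr_gt0//;
  exact: root_density_gt0.
apply: measurable_funM; first exact: (measurable_funB m1 m2).
apply: (measurableT_comp (@measurable_expR R)).
exact: (measurable_funN m3).
Qed.

Section moments.
Variables (g g0 : W -> R).
Hypotheses (mg : measurable_fun setT g) (mg0 : measurable_fun setT g0).

Definition ratio_mean : R :=
  fine (\int[M]_z ((1 + f g g0 z) * k z)%:E)%E - 1.

Definition ratio_sqr_mean : R := fine (\int[M]_z (f g g0 z ^+ 2 * k z)%:E)%E.

Let k_int : ge0_integral_is M k 1.
Proof. exact: integral_cond_density. Qed.

Let ratio_mean_int : ge0_integral_is M (fun z => (1 + f g g0 z) * k z) (1 + ratio_mean).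
Proof.
rewrite /ratio_mean addrC subrK.
apply: (ge0_integral_is_dominated (E := fun z => 2 * k z)); last first.
- exact: (@ge0_integral_isZ _ _ _ _ _ _ 2 ltac:(by []) k_int).
- move=> z; have := f1 g g0 z; rewrite ler_norml => /andP[? ?].
  by apply/andP; split; [rewrite mulr_ge0//; lra|rewrite ler_wpM2r//; lra].
- by apply: measurable_funM => //; apply: measurable_funD => //; exact: mf.
Qed.

Let ratio_sqr_mean_int : ge0_integral_is M (fun z => f g g0 z ^+ 2 * k z) ratio_sqr_mean.
Proof.
apply: (ge0_integral_is_dominated (E := fun z => k z)); last first.
- exact: k_int.
- move=> z; rewrite mulr_ge0 ?sqr_ge0//= ler_piMl//.
  by rewrite -real_normK ?num_real// expr_le1.
- by apply: measurable_funM => //; apply: measurable_funX; exact: mf.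
Qed.

Lemma ratio_meanE i : (\int[P]_w (f g g0 (X i w))%:E = ratio_mean%:E)%E.
Proof.
have -> : ratio_mean = 1 + ratio_mean - 1 by rewrite addrC addKr.
have mfX : measurable_fun setT (fun w => f g g0 (X i w)).
  by apply: measurableT_comp => //; exact: mf.
apply: ge0_integral_sub1 => //.
have mfg := mf mg mg0.
have mf1 : measurable_fun setT (fun z => (1 + f g g0 z)%:E).
  by apply/measurable_EFinP; exact: (measurable_funD (measurable_cst (1 : R)) mfg).
have f1_ge0 z : (0 <= (1 + f g g0 z)%:E)%E.
  have := f1 g g0 z; rewrite lee_fin ler_norml => /andP[h _].
  by rewrite -lerBlDl sub0r.
rewrite (integral_law i mf1 f1_ge0).
by have [_ _ <-] := ratio_mean_int; apply: eq_integral => z _; rewrite EFinM.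
Qed.

Lemma ratio_sqr_meanE i :
  (\int[P]_w (f g g0 (X i w) ^+ 2)%:E = ratio_sqr_mean%:E)%E.
Proof.
have mfg := mf mg mg0.
have mf2 : measurable_fun setT (fun z => (f g g0 z ^+ 2)%:E).
  by apply/measurable_EFinP; exact: (measurable_funX 2 mfg).
have f2_ge0 z : (0 <= (f g g0 z ^+ 2)%:E)%E by rewrite lee_fin; exact: sqr_ge0.
rewrite (integral_law i mf2 f2_ge0).
by have [_ _ <-] := ratio_sqr_mean_int; apply: eq_integral => z _; rewrite EFinM.
Qed.

Let rd0 (h : W -> R) (z : W * Y) : 0 < rd (h z.1) z.2.
Proof. exact: root_density_gt0. Qed.

Lemma ratio_mean_le : ratio_mean <= 7 / 2 * hell gs g0 - 3 / 8 * hell gs g.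
Proof.
exact: (psi_mean_le (s := fun z => rd (gs z.1) z.2) (rd0 g0) (rd0 g) k_int
  (integral_cond_density PW v_le nuT B_fin mg0)
  (integral_cond_density PW v_le nuT B_fin mg)
  (hell2_integral PW v_le nuT B_fin mgs mg0)
  (hell2_integral PW v_le nuT B_fin mgs mg) ratio_mean_int).
Qed.

Lemma ratio_sqr_mean_le : ratio_sqr_mean <= 4 * (hell gs g0 + hell gs g).
Proof.
exact: (psi_sqr_mean_le (s := fun z => rd (gs z.1) z.2) (rd0 g0) (rd0 g)
  (hell2_integral PW v_le nuT B_fin mgs mg0)
  (hell2_integral PW v_le nuT B_fin mgs mg) ratio_sqr_mean_int).
Qed.

End moments.

Let g0 : W -> R := rat_lin c0.
Let gk j : W -> R := rat_lin (coef_nth j).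
Let fk j := f (gk j) g0.
Let penk j := model_pen n (weight R) (@model_nth p j).
Let dev j w := deviation X fk (fun i => ratio_mean (gk i) g0)
  (fun i => ratio_sqr_mean (gk i) g0) penk j w.
Let dev_sup w := ereal_sup [set (Num.max 0 (dev j w))%:E | j in setT].

Let ratio_le (r s t : R) : 0 < r -> 0 < s -> s <= t ->
  (s - r) / (s + r) <= (t - r) / (t + r).
Proof.
move=> r0 s0 st; have t0 := lt_le_trans s0 st.
rewrite ler_pdivrMr ?addr_gt0// mulrAC ler_pdivlMr ?addr_gt0//.
by rewrite -subr_ge0 (_ : _ - _ = 2 * r * (t - s)); [rewrite !mulr_ge0// ?subr_ge0// ltW|ring].
Qed.

Let ratio_min (r s t u : R) : 0 < r -> 0 < s -> 0 < t -> Num.min s t <= u ->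
  Num.min ((s - r) / (s + r)) ((t - r) / (t + r)) <= (u - r) / (u + r).
Proof.
move=> r0 s0 t0; rewrite !ge_min => /orP[su|tu].
  by rewrite ratio_le.
by rewrite (ratio_le r0 t0 tu) orbT.
Qed.

Let integral_dev_sup : (\int[P]_w dev_sup w <= 512%:E)%E.
Proof.
apply: (symmetrization (f := fk) (a := fun i => ratio_mean (gk i) g0)
  (b := fun i => ratio_sqr_mean (gk i) g0) (pen := penk) (B := 512)
  indepX) => //.
- by move=> j; apply: mf; exact: mlin.
- by move=> j x; exact: f1.
- by move=> j i; apply: ratio_meanE; exact: mlin.
- by move=> j i; apply: ratio_sqr_meanE; exact: mlin.
move=> z.
pose r ib := rd (g0 (z ib).1) (z ib).2.
have r_gt0 ib : 0 < r ib by exact: root_density_gt0.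
(* With the data fixed, a candidate only enters through its linear predictor [t]; as
   [u -> (u - r) / (u + r)] is increasing, [phi] inherits the quasi-concavity of [root_density]. *)
pose phi ib t := (rd t (z ib).2 - r ib) / (rd t (z ib).2 + r ib).
have phi1 ib t : `|phi ib t| <= 1.
  by apply: ratio_le1 => //; exact: root_density_gt0.
have phiq ib r1 s1 t1 : r1 <= s1 -> s1 <= t1 ->
    Num.min (phi ib r1) (phi ib t1) <= phi ib s1.
  move=> rs st; apply: ratio_min; [exact: r_gt0|exact: root_density_gt0| |].
    exact: root_density_gt0.
  exact: (root_density_quasi_concave v_le nuT B_fin _ rs st).
have [G [G0 Gub GB]] := @all_models_sup_bound R n p
  (fun ib j => tnth (covariates (z ib).1) j) phi phi1 phiq.
exists G; split => // e j.
exact: (Gub e (model_nth j) (coef_nth j) (@coef_nth_supp p j)).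
Qed.

Let measurable_dev j : measurable_fun setT (dev j).
Proof.
have mfX i : measurable_fun setT (fun w => fk j (X i w)).
  by apply: measurableT_comp => //; apply: mf; exact: mlin.
by do 3 (apply: measurable_funB => //); apply: measurable_sum.
Qed.

Let measurable_dev_sup : measurable_fun setT dev_sup.
Proof.
have -> : dev_sup = fun w => esups (fun j => (Num.max 0 (dev j w))%:E) 0%N.
  apply/funext => w; congr ereal_sup; apply/seteqP; split => [_ [j _ <-]|_ [j _ <-]];
  by exists j.
apply: measurable_fun_esups => j; apply/measurable_EFinP.
by apply: measurable_maxr => //; exact: measurable_cst.
Qed.

Let dev_sup_ge0 w : (0 <= dev_sup w)%E.
Proof.
apply: (@le_trans _ _ (Num.max 0 (dev 0 w))%:E).
  by rewrite lee_fin le_max lexx.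
by apply: ereal_sup_ubound; exists 0%N.
Qed.

Let dev_sup_ub w j : ((dev j w)%:E <= dev_sup w)%E.
Proof.
apply: (@le_trans _ _ (Num.max 0 (dev j w))%:E).
  by rewrite lee_fin le_max lexx orbT.
by apply: ereal_sup_ubound; exists j.
Qed.

Local Notation pen := (penalty (n := n) vm vp (all_models p) (weight R)).

Let enum_GU (g : W -> R) : GU g -> exists j, g = cl \o gk j /\ pen g = penk j.
Proof.
move=> /Gamma_unionP[m1 m1g].
have [m [[h [c [cm hE]] ghE] penE _]] := penaltyP (n := n) m1g.
have [j [mj cj]] := model_nth_surj cm; exists j; split.
  by rewrite -ghE hE /gk cj.
by rewrite penE /penk mj.
Qed.

Let sample w : n.-tuple (W * Y)%type := [tuple X i w | i < n].

Let test_sample w j :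
  test_stat nu T (sample w) (cl \o g0) (cl \o gk j) = \sum_i fk j (X i w).
Proof.
have E (h : W -> R) z :
    Num.sqrt (expfam_density nu T ((cl \o h) z.1) z.2) = rd (h z.1) z.2.
  exact: sqrt_expfam_density.
rewrite test_statE; apply: eq_bigr => i _.
rewrite tnth_mktuple.
have E1 := E (gk j) (X i w).
have E2 := E g0 (X i w).
exact: (congr2 (fun s t => (s - t) / (s + t)) E1 E2).
Qed.

Let h0 := hell gs g0.
Let pen0 := model_pen n (weight R) m0.

Let g0_GU : GU (cl \o g0).
Proof.
apply/Gamma_unionP; exists m0; exists g0 => //; exists c0; split => //.
Qed.

Let pen_g0 : pen (cl \o g0) <= pen0.
Proof.
have : Gamma hW vm vp m0 (cl \o g0) by exists g0 => //; exists c0; split.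
by move=> m0g; have [m [_ -> ]] := penaltyP (n := n) m0g.
Qed.

(** The second moment is charged at the rate 1/25: [183 / 50 = 7 / 2 + 4 / 25] and
    [43 / 200 = 3 / 8 - 4 / 25]. *)
Let sample_sum_le w j (z : R) : dev_sup w = z%:E ->
  \sum_i fk j (X i w) - penk j <=
  n%:R * (183 / 50 * h0 - 43 / 200 * hell gs (gk j)) + z.
Proof.
move=> zE; have := dev_sup_ub w j; rewrite zE lee_fin /dev /deviation.
have := ratio_mean_le (mlin (coef_nth j)) (mlin c0).
have := ratio_sqr_mean_le (mlin (coef_nth j)) (mlin c0).
rewrite -/g0 -/(gk j) -/h0.
have n0 : 0 <= n%:R :> R by [].
move: (\sum_i _) (ratio_mean _ _) (ratio_sqr_mean _ _) (hell _ _) (penk j) => S A B H Q.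
move=> hB hA hz.
have hA' : n%:R * A <= n%:R * (7 / 2 * h0 - 3 / 8 * H) by exact: ler_wpM2l.
have hB' : n%:R * B <= n%:R * (4 * (h0 + H)) by exact: ler_wpM2l.
lra.
Qed.

(** [sample_sum_le] acts twice: for all competitors, dropping the negative term, to bound the
    supremum at [g0]; and for the estimator, keeping it. This doubles [183 / 50] and the
    deviation. *)
Lemma oracle_pointwise w :
  (cond_hellinger2 mu PW (expfam_cond nu a T gs) (expfam_cond nu a T (ghat (sample w)))
   <= ((183 / 25 * h0 + (2 * pen0 + 1) / n%:R) / (43 / 200))%:E +
      (2 / n%:R / (43 / 200))%:E * dev_sup w)%E.
Proof.
have [_ /(_ (sample w)) [ghU ups_le]] := ghatP.
have [j [ghE penE]] := enum_GU ghU.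
have nR : 0 < n%:R :> R by rewrite ltr0n.
rewrite ghE -[in expfam_cond nu a T gs]clgs.
rewrite (cond_hellinger2E PW v_le nuT B_fin a0 nuE mgs (mlin _)).
have B0 : 0 < 2 / n%:R / (43 / 200) :> R.
  have q0 : 0 < 43 / 200 :> R by lra.
  have q1 : 0 < 2 / n%:R :> R by rewrite divr_gt0.
  exact: divr_gt0 q1 q0.
case zE : (dev_sup w) => [z| |]; last 2 first.
- rewrite gt0_muley; last by rewrite lte_fin; exact: B0.
  by rewrite addey; [exact: leey|].
- by have := dev_sup_ge0 w; rewrite zE.
have hell0 i : 0 <= hell gs (gk i) by apply: hell2_ge0 => //; exact: mlin.
have le_S g : GU g -> test_stat nu T (sample w) (cl \o g0) g - pen g <=
    n%:R * (183 / 50 * h0) + z.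
  move=> /enum_GU[i [-> ->]]; rewrite test_sample.
  apply: (le_trans (sample_sum_le i zE)); rewrite lerD2r ler_wpM2l ?ler0n//.
  by rewrite gerBl mulr_ge0.
have := estimator_le ghU g0_GU ups_le le_S.
rewrite ghE test_sample -ghE penE; have := sample_sum_le j zE; have := pen_g0.
rewrite -EFinM -EFinD lee_fin -/(gk j).
move: (pen _) (\sum_i _) (penk j) (hell gs (gk j)) pen0 h0 => p1 S Q H p0 h.
move=> p01 hS hQ.
apply: oracle_arith => //; lra.
Qed.

(** The tolerance 1 of the estimator plus twice the deviation bound 512 make 1025. *)
Lemma oracle_bound :
  (\int[P]_w cond_hellinger2 mu PW (expfam_cond nu a T gs)
       (expfam_cond nu a T (ghat [tuple X i w | i < n]))
   <= ((183 / 25 * h0 + (2 * pen0 + 1025) / n%:R) / (43 / 200))%:E)%E.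
Proof.
have nR : 0 < n%:R :> R by rewrite ltr0n.
set A := (183 / 25 * h0 + (2 * pen0 + 1) / n%:R) / (43 / 200).
set B := 2 / n%:R / (43 / 200) : R.
have h00 : 0 <= h0 by apply: hell2_ge0 => //; exact: mlin.
have p00 : 0 <= pen0 by exact: model_pen_ge0.
have q0 : 0 < 43 / 200 :> R by lra.
have B0 : 0 <= B.
  by apply: divr_ge0; [apply: divr_ge0; [lra|exact: ltW]|exact: ltW].
have A0 : 0 <= A.
  apply: divr_ge0; last exact: ltW.
  by apply: addr_ge0; [apply: mulr_ge0; [lra|]|apply: divr_ge0; [lra|exact: ltW]].
apply: (@le_trans _ _ (\int[P]_w (A%:E + B%:E * dev_sup w))%E).
  apply: ge0_le_integral_nonmeas => w; last exact: oracle_pointwise.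
  by apply: integral_ge0 => z _; rewrite lee_fin sqr_ge0.
rewrite ge0_integralD//; last 2 first.
- by move=> w _; rewrite mule_ge0 ?lee_fin.
- exact: measurable_funeM.
rewrite integral_cst// [X in (_ * X + _)%E]probability_setT mule1.
rewrite ge0_integralZl_EFin//.
apply: (@le_trans _ _ (A%:E + B%:E * 512%:E)%E).
  by rewrite leeD2l// lee_wpmul2l// lee_fin.
rewrite -EFinM -EFinD lee_fin /A /B le_eqVlt; apply/orP; left; apply/eqP.
by field; rewrite gt_eqF.
Qed.

End oracle.

(** * Rational approximation and final constants *)

Lemma sigma_finite_measure_of (R : realType) (d : measure_display)
    (Y : measurableType d) (nu : {measure set Y -> \bar R}) :
  sigma_finite setT nu ->
  exists nu' : {sigma_finite_measure set Y -> \bar R},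
    (nu' : {measure set Y -> \bar R}) = nu.
Proof.
case: nu => [nu nuM] sf.
pose mnu : {measure set Y -> \bar R} := Measure.Pack nuM.
pose mix := @Measure_isSigmaFinite.Build _ _ _ mnu sf.
by exists (HB.pack_for {sigma_finite_measure set Y -> \bar R} nu mnu mix).
Qed.

Lemma rational_linear_approximation (R : realType) (p : nat) (WW : set (p.-tuple R))
    (hW : WW !=set0) (m : {set 'I_p}) (c : 'I_p -> R) :
  (forall j, j \notin m -> c j = 0) ->
  exists q : nat -> 'I_p -> rat, (forall k j, j \notin m -> q k j = 0) /\
    forall w : covariate_space hW,
      (fun k => linear_fun (fun j => ratr (q k j)) w) @ \oo --> linear_fun c w.
Proof.
move=> cm.
have step (kj : nat * 'I_p) : exists q : rat, (kj.2 \notin m -> q = 0) /\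
    `|c kj.2 - ratr q| <= harmonic kj.1.
  case: kj => k j /=; have h0 : 0 < harmonic k :> R by exact: harmonic_gt0.
  have [jm|jm] := boolP (j \in m); last first.
    by exists 0; split => //; rewrite cm// raddf0 subrr normr0 ltW.
  have [|q] := @rat_in_itvoo R (c j) (c j + k.+1%:R^-1).
    by rewrite ltrDl invr_gt0.
  rewrite in_itv/= => /andP[q1 q2]; exists q; split => //.
  rewrite ler_norml; move: (k.+1%:R^-1) q2 => t q2.
  by apply/andP; split; lra.
have [q qP] := boolp.choice step.
exists (fun k j => q (k, j)); split => [k j jm|w].
  by have [/(_ jm)] := qP (k, j).
set S := \sum_j `|tnth (covariates w) j|.
have S0 : 0 <= S by apply: sumr_ge0.
apply/cvgrPdist_le => e e0.
have e1 : 0 < e / (S + 1) by rewrite divr_gt0// ltr_wpDl.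
have := @cvg_harmonic R; move/cvgrPdist_le => /(_ _ e1); apply: filterS => k.
rewrite sub0r normrN ger0_norm ?harmonic_ge0// => hk.
rewrite /linear_fun -sumrB (le_trans (ler_norm_sum _ _ _))//.
apply: (@le_trans _ _ (\sum_j harmonic k * `|tnth (covariates w) j|)).
  apply: ler_sum => j _; rewrite -mulrBl normrM ler_wpM2r//.
  by have [] := qP (k, j).
rewrite -mulr_sumr -/S.
have : harmonic k * (S + 1) <= e by rewrite -ler_pdivlMr// ltr_wpDl.
have := @harmonic_ge0 R k; nra.
Qed.

(** The dominant term is [2 * 10 ^+ 6 / (43 / 200)], about [9.31 * 10 ^+ 6]; the excess [1 / N] of
    [h] and the constant 1025 are absorbed thanks to [1 <= r]. *)
Lemma oracle_constants (R : realFieldType) (N H h q r : R) : 1 <= N -> 1 <= r ->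
  0 <= H -> h <= H + 1 / N -> q <= 10 ^+ 6 * r ->
  (183 / 25 * h + (2 * q + 1025) / N) / (43 / 200) <=
  195 / 100 * 10 ^+ 7 * (H + r / N).
Proof.
move=> N1 r1 H0 hH qr; set s := N^-1.
have N0 : 0 < N by lra.
have s0 : 0 <= s by rewrite invr_ge0 ltW.
have rs : s <= r * s by rewrite ler_peMl.
have qs : q * s <= 10 ^+ 6 * r * s by rewrite ler_wpM2r.
rewrite mul1r -/s in hH *.
lra.
Qed.

Theorem corollary6 (R : realType)
  (p n : nat) (hp : (1 <= p)%N) (hn : (1 <= n)%N)
  (WW : set (p.-tuple R)) (hW : WW !=set0)
  (PW : probability (covariate_space hW) R)
  (I : set R) (hI : is_interval I) (hI0 : interior I !=set0)
  (dY : measure_display) (Y : measurableType dY)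
  (mu nu : {measure set Y -> \bar R})
  (a : {mfun Y >-> R}) (ha : forall y, 0 <= a y)
  (hnu : forall A, measurable A -> nu A = (\int[mu]_(y in A) (a y)%:E)%E)
  (T : {mfun Y >-> R}) (hT : ~ exists c : R, {ae nu, forall y, T y = c})
  (hB : forall g, I g -> (\int[nu]_y (expR (g * T y))%:E < +oo)%E)
  (vm vp : R) (hv : vm < vp) (hvI : `[vm, vp] `<=` I)
  (cstar : 'I_p -> R)
  (hstar : forall w : covariate_space hW, linear_fun cstar w \in `[vm, vp])
  (dO : measure_display) (Omega : measurableType dO) (P : probability Omega R)
  (X : 'I_n -> {mfun Omega >-> (covariate_space hW * Y)%type})
  (hindep : mutually_independent P (fun i => X i : Omega -> _))
  (hlaw : forall i, has_conditional_law P (X i) PW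
            (fun w => expfam nu T (linear_fun cstar w)))
  (ghat : n.-tuple (covariate_space hW * Y)%type -> covariate_space hW -> R)
  (hghat : is_estimator nu T vm vp (all_models p) (weight R) ghat) :
  (\int[P]_omega
     cond_hellinger2 mu PW
       (expfam_cond nu a T (linear_fun cstar))
       (expfam_cond nu a T (ghat [tuple X i omega | i < n]))
   <= (195 / 100 * 10 ^+ 7)%:E *
      Order.min
        (bound_ordered mu nu a T vm vp PW n (linear_fun cstar))
        (bound_complete mu nu a T vm vp PW n (linear_fun cstar)))%E.
Proof.
have v_le : vm <= vp by exact: ltW.
have B_fin g : vm <= g <= vp -> (\int[nu]_y (expR (g * T y))%:E < +oo)%E.
  by move=> gI; apply: hB; apply: hvI; rewrite /= in_itv.
have [nu' nuE] := sigma_finite_measure_of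
  (exponential_family_sigma_finite v_le B_fin).
subst nu.
set gs : covariate_space hW -> R := linear_fun cstar.
have gsI w : vm <= gs w <= vp by have := hstar w; rewrite in_itv.
have mgs : measurable_fun setT gs by exact: measurable_linear_fun.
have clgs : clip vm vp \o gs = gs by apply/funext => w /=; rewrite clip_id.
set risk := (\int[P]_omega _)%E.
have risk0 : (0 <= risk)%E.
  by apply: integral_ge0 => w _; apply: integral_ge0 => z _; rewrite lee_fin sqr_ge0.
pose K : R := 195 / 100 * 10 ^+ 7.
have K0 : 0 < K by rewrite /K; lra.
have nR : 1 <= n%:R :> R by rewrite ler1n.
(* A real [c] is approximated by rational ones until the bias is within [1 / n] of its limit. *)
have main (m : {set 'I_p}) (c : 'I_p -> R) (r : R) :
    (forall j, j \notin m -> c j = 0) -> 1 <= r ->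
    model_pen n (weight R) m <= 10 ^+ 6 * r ->
  (risk <= (K * (hell2 PW nu' T vm vp gs (linear_fun c) + r / n%:R))%:E)%E.
  move=> cm r1 mr.
  have [q [qm qc]] := rational_linear_approximation hW cm.
  have mq k : measurable_fun setT (@linear_fun R p WW hW (fun j => ratr (q k j))).
    exact: measurable_linear_fun.
  have mc : measurable_fun setT (@linear_fun R p WW hW c).
    exact: measurable_linear_fun.
  have := hell2_cvg (PW := PW) v_le hT B_fin mgs mc mq qc.
  have n1 : 0 < 1 / n%:R :> R by rewrite divr_gt0//; lra.
  move/cvgrPdist_le => /(_ _ n1) [k _ /(_ k (leqnn k))].
  rewrite ler_norml => /andP[hk _].
  apply: (le_trans (oracle_bound hn ha hnu hT v_le B_fin mgs gsI hindep hlaw hghat (qm k))).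
  rewrite lee_fin /K; apply: oracle_constants => //.
    exact: hell2_ge0.
  by rewrite -lerBlDl; rewrite lerNl opprB in hk.
(* A real-valued risk can be divided by [K] before the infima are taken. The empty model already
   shows finiteness, [r] being chosen as a maximum to meet both conditions of [main]. *)
have risk_fin : risk \is a fin_num.
  rewrite ge0_fin_numE//.
  apply: le_lt_trans (ltry _); apply: (main finset.set0 (fun=> 0)
    (Num.max 1 (model_pen n (weight R) (finset.set0 : {set 'I_p}) / 10 ^+ 6))) => //.
    by rewrite le_max lexx.
  by rewrite mulrC -ler_pdivrMr ?exprn_gt0// le_max lexx orbT.
have riskE : risk = (fine risk)%:E by rewrite fineK.
have bias_le (m : {set 'I_p}) (r : R) : 1 <= r ->
    model_pen n (weight R) m <= 10 ^+ 6 * r ->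
  ((fine risk / K)%:E <= cond_hellinger2_set mu PW (expfam_cond nu' a T gs)
      (Qbar hW vm vp nu' a T m) + (r / n%:R)%:E)%E.
  move=> r1 mr; rewrite -leeBlDr//; apply: le_ereal_inf_tmp => _ [_ [_ [_ [c [cm ->]] <-] <-] <-].
  have mc : measurable_fun setT (@linear_fun R p WW hW c).
    exact: measurable_linear_fun.
  have := main m c r cm r1 mr; rewrite riskE lee_fin => h.
  rewrite -[in expfam_cond nu' a T gs]clgs.
  rewrite (cond_hellinger2E PW v_le hT B_fin ha hnu mgs mc) -EFinB lee_fin.
  by rewrite lerBlDr ler_pdivrMr// mulrC.
suff h : ((fine risk / K)%:E <= Order.min
    (bound_ordered mu nu' a T vm vp PW n gs)
    (bound_complete mu nu' a T vm vp PW n gs))%E.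
  have -> : risk = (K%:E * (fine risk / K)%:E)%E.
    by rewrite -EFinM mulrC divfK ?gt_eqF.
  by apply: lee_wpmul2l => //; rewrite lee_fin ltW.
have V1 (m : {set 'I_p}) : 1 <= (#|m|.+1)%:R :> R by rewrite ler1n.
rewrite le_min; apply/andP; split; apply: le_ereal_inf_tmp => _ [m /= mo <-].
- rewrite mulrAC; apply: bias_le; last exact: model_pen_ordered_le.
  by rewrite -[leLHS]mul1r ler_pM// lerDl log_plus_ge0.
- rewrite mulrAC; apply: bias_le; last exact: model_pen_le.
  (* The logarithm is non-negative because [#|m| + 1 <= 2 * p], as [1 <= p]. *)
  rewrite -[leLHS]mul1r ler_pM// lerDl ln_ge0//.
  rewrite ler_pdivlMr ?ltr0n// mul1r ler_nat (leq_trans _ (leq_maxl _ _))//.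
  by rewrite mul2n -addnn -addn1 leq_add// card_model_le.
Qed.
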